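(* Suppose $\lambda\le -1$ and $(S,T)$ is a closed triangulated surface with vertex set $V$. (a) The space $K_\lambda(CP_{\mathbb E^2}(S,T))$ of all $\lambda$-th discrete curvatures of Euclidean circle packing metrics on $(S,T)$ is a proper (i.e. closed as a subset) codimension-1 smooth submanifold of $\mathbb R^V$. (b) The space $K_\lambda(CP_{\mathbb H^2}(S,T))$ of all $\lambda$-th discrete curvatures of hyperbolic circle packing metrics on $(S,T)$ is an open set in $\mathbb R^V$ bounded by $K_\lambda(CP_{\mathbb E^2}(S,T))$, i.e. every boundary point of $K_\lambda(CP_{\mathbb H^2}(S,T))$ in $\mathbb R^V$ belongs to $K_\lambda(CP_{\mathbb E^2}(S,T))$.
   Context: A closed triangulated surface $(S,T)$ is a connected closed surface obtained from a finite disjoint union of triangles by identifying all edges in pairs by homeomorphisms; $T$ is the resulting cell structure (cells need not be embedded), with vertex set $V$, edge set $E$ and set of triangles $T^{(2)}$. Each triangle is counted as having three vertices, edges and corners (with multiplicity). For $K^2=\mathbb E^2$ or $\mathbb H^2$, a circle packing metric on $(S,T)$ is given by a radius assignment $r:V\to\mathbb R_{>0}$: each edge with end points $v,v'$ has length $r(v)+r(v')$ and each triangle of $T$ is realized as the triangle in $K^2$ with these edge lengths. $CP_{K^2}(S,T)$, identified with $\mathbb R_{>0}^V$ by $r$, is the space of all of them. The $\lambda$-th discrete curvature is $k_\lambda(v)=\sum_{i=1}^m\int_{\pi/2}^{\theta_i}\tan^\lambda(t/2)\,dt$, where $\theta_1,\dots,\theta_m$ are all the inner angles at the vertex $v$,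 and $K_\lambda:CP_{K^2}(S,T)\to\mathbb R^V$ sends a metric to $k_\lambda$. *)

(* Defs.v *)
From HB Require Import structures.
From mathcomp Require Import all_boot all_order all_algebra.
From mathcomp Require Import all_classical all_reals all_analysis.
From mathcomp Require Import ring lra.

Set Implicit Arguments.
Unset Strict Implicit.
Unset Printing Implicit Defensive.

Import Order.TTheory GRing.Theory Num.Theory.
Import numFieldNormedType.Exports.

Local Open Scope classical_set_scope.
Local Open Scope ring_scope.

(* The pair (f, i) with i : 'I_3 (indices mod 3) stands both for the i-th corner
   of the triangle f and for the side of f opposite to that corner; the end
   points of that side are the corners i + 1 and i + 2. *)
Definition endpoint (F : finType) (e : F * 'I_3) (b : bool) : F * 'I_3 :=
  (e.1, if b then e.2 + 1 else e.2 + 2).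

Section Gluing.
Variables (F : finType) (glue : F * 'I_3 -> F * 'I_3) (twist : F * 'I_3 -> bool).

(* Up to isotopy a homeomorphism between two sides is determined by what it does
   on end points: it sends the end point b of e to the end point b (+) twist e
   of glue e. *)
Definition corner_glued : rel (F * 'I_3) := fun c d =>
  [exists e, [exists b,
    (c == endpoint e b) && (d == endpoint (glue e) (b (+) twist e))]].

Definition face_adjacent : rel F := fun f g =>
  [exists i, [exists j, glue (f, i) == (g, j)]].

End Gluing.

(* A side may be glued to another side of the same triangle, and both
   orientations are allowed, so cells need not be embedded and the surface need
   not be orientable. The vertices are the classes of corners under the
   equivalence relation generated by the gluing, numbered by 'I_nvert, so that
   R^V is 'rV[R]_nvert. *)
Record closed_tri_surface := ClosedTriSurface {
  face : finType;
  glue : face * 'I_3 -> face * 'I_3;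
  twist : face * 'I_3 -> bool;
  glueK : involutive glue;
  glue_neq : forall e, glue e != e;
  twist_glue : forall e, twist (glue e) = twist e;
  face_nonempty : (0 < #|face|)%N;
  face_connected : forall f g, connect (face_adjacent glue) f g;
  nvert : nat;
  vert : face * 'I_3 -> 'I_nvert;
  vert_surj : forall v, exists c, vert c = v;
  vert_eq : forall c d,
    (vert c == vert d) = connect (corner_glued glue twist) c d
}.

Section Angles.
Variable R : realType.

Definition cosh (x : R) : R := (expR x + expR (- x)) / 2.
Definition sinh (x : R) : R := (expR x - expR (- x)) / 2.

(* [eucl_angle b c a] and [hyp_angle b c a] are the inner angle, between the
   sides of lengths b and c, of the triangle of E^2 (resp. H^2) whose third side
   has length a; see [eucl_angleE] and [hyp_angleE]. *)
Definition eucl_angle (b c a : R) : R :=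
  acos ((b ^+ 2 + c ^+ 2 - a ^+ 2) / (2 * b * c)).

Definition hyp_angle (b c a : R) : R :=
  acos ((cosh b * cosh c - cosh a) / (sinh b * sinh c)).

Definition dot (u v : 'rV[R]_2) : R := u 0 0 * v 0 0 + u 0 1 * v 0 1.

Lemma eucl_angleE (p q r : 'rV[R]_2) (a b c : R) :
    a = Num.sqrt (dot (q - r) (q - r)) ->
    b = Num.sqrt (dot (q - p) (q - p)) ->
    c = Num.sqrt (dot (r - p) (r - p)) ->
  eucl_angle b c a = acos (dot (q - p) (r - p) / (b * c)).
Proof.
have dot0 u : 0 <= dot u u by rewrite /dot -!expr2 addr_ge0 ?sqr_ge0.
move=> -> -> ->; rewrite /eucl_angle !sqr_sqrtr //; congr acos.
set x := (X in X / _); have -> : x = 2 * dot (q - p) (r - p).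
  by rewrite {}/x /dot !mxE; ring.
by rewrite -[2 * _ * _]mulrA -mulf_div divff ?mul1r // pnatr_eq0.
Qed.

(* Hyperboloid model of H^2: the points p with p_0 > 0 and mink p p = -1, where
   the distance d between p and q is given by cosh d = - mink p q. The unit
   tangent vector at p pointing to q is the normalization of
   q + (mink p q) *: p. *)
Definition mink (u v : 'rV[R]_3) : R :=
  - (u 0 0 * v 0 0) + u 0 1 * v 0 1 + u 0 2 * v 0 2.

Definition hyp_dir (p q : 'rV[R]_3) : 'rV[R]_3 := q + mink p q *: p.

Lemma hyp_angleE (p q r : 'rV[R]_3) (a b c : R) :
    mink p p = -1 -> mink q q = -1 -> mink r r = -1 ->
    0 <= b -> 0 <= c ->
    cosh a = - mink q r -> cosh b = - mink p q -> cosh c = - mink p r ->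
  hyp_angle b c a =
    acos (mink (hyp_dir p q) (hyp_dir p r) /
          (Num.sqrt (mink (hyp_dir p q) (hyp_dir p q)) *
           Num.sqrt (mink (hyp_dir p r) (hyp_dir p r)))).
Proof.
move=> pp qq rr b0 c0 ha hb hc.
have dirE x y : mink (hyp_dir p x) (hyp_dir p y) =
    mink x y + mink p x * mink p y * (2 + mink p p).
  by rewrite /hyp_dir {1}/mink !mxE /mink; ring.
have sinh2 x : sinh x ^+ 2 = cosh x ^+ 2 - 1.
  rewrite /sinh /cosh; have := expRxMexpNx_1 x.
  move: (expR x) (expR (- x)) => u v uv.
  have -> : ((u + v) / 2) ^+ 2 - 1 = ((u - v) / 2) ^+ 2 + (u * v - 1) by field.
  by rewrite uv subrr addr0.
have sinh0 x : 0 <= x -> 0 <= sinh x.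
  by move=> x0; rewrite divr_ge0 // subr_ge0 ler_expR; lra.
have sqE x y : 0 <= x -> mink y y = -1 -> cosh x = - mink p y ->
    Num.sqrt (mink (hyp_dir p y) (hyp_dir p y)) = sinh x.
  move=> x0 yy h; rewrite -[RHS]ger0_norm ?sinh0 // -sqrtr_sqr sinh2.
  by rewrite dirE yy pp h; congr Num.sqrt; ring.
rewrite (sqE b q) // (sqE c r) // dirE pp /hyp_angle ha hb hc.
by congr (acos (_ / _)); ring.
Qed.

End Angles.

Section Curvature.
Variable R : realType.

Definition oriented_integral (f : R -> R) (a b : R) : R :=
  if a <= b then \int[lebesgue_measure]_(t in `[a, b]) f t
  else - \int[lebesgue_measure]_(t in `[b, a]) f t.

Variables (lambda : R) (S : closed_tri_surface).

(* The identification of CP_{K^2}(S, T) with R_{>0}^V. *)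
Definition CP : set 'rV[R]_(nvert S) := [set r | forall v, 0 < r 0 v].

Definition edge_length (r : 'rV[R]_(nvert S)) (e : face S * 'I_3) : R :=
  r 0 (vert (endpoint e true)) + r 0 (vert (endpoint e false)).

(* The inner angle at the corner c, with [angle] one of the two functions
   above; the side opposite to c is c itself, the other two are c.2 +/- 1. *)
Definition corner_angle (angle : R -> R -> R -> R) (r : 'rV[R]_(nvert S))
    (c : face S * 'I_3) : R :=
  angle (edge_length r (c.1, c.2 + 1)) (edge_length r (c.1, c.2 + 2))
        (edge_length r c).

Definition curvature (angle : R -> R -> R -> R) (r : 'rV[R]_(nvert S)) :
    'rV[R]_(nvert S) :=
  \row_v \sum_(c | vert c == v)
    oriented_integral (fun t => tan (t / 2) `^ lambda) (pi / 2)
      (corner_angle angle r c).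

Definition K_eucl := curvature (@eucl_angle R).
Definition K_hyp := curvature (@hyp_angle R).

End Curvature.

Arguments CP : clear implicits.
Arguments K_eucl {R} lambda S r.
Arguments K_hyp {R} lambda S r.

Section Submanifold.
Variable R : realType.

(* Class C^k on the open set U of R^m. *)
Fixpoint Ck_on (k m n : nat) (U : set 'rV[R]_m) (f : 'rV[R]_m -> 'rV[R]_n) :
    Prop :=
  (forall x, U x -> {for x, continuous f}) /\
  (if k is k'.+1 then
     forall v, (forall x, U x -> derivable f x v) /\ Ck_on k' U ('D_v f)
   else True).

Definition smooth_on (m n : nat) (U : set 'rV[R]_m) (f : 'rV[R]_m -> 'rV[R]_n) :
    Prop :=
  forall k, Ck_on k U f.

(* Around each of its points M is, in a smooth chart of R^n, the set where the
   d coordinates indexed by I vanish. *)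
Definition smooth_submanifold (n : nat) (d : nat) (M : set 'rV[R]_n) : Prop :=
  forall p, M p ->
    exists (U W : set 'rV[R]_n) (phi psi : 'rV[R]_n -> 'rV[R]_n)
           (I : {set 'I_n}),
      [/\ open U, U p & open W] /\
      [/\ smooth_on U phi, smooth_on W psi,
          (forall x, U x -> W (phi x) /\ psi (phi x) = x) &
          (forall y, W y -> U (psi y) /\ phi (psi y) = y)] /\
      #|I| = d /\
      (forall x, U x -> (M x <-> forall i, i \in I -> phi x 0 i = 0)).

End Submanifold.

Definition topological_boundary (T : topologicalType) (A : set T) : set T :=
  closure A `\` interior A.

(* Main.v *)
(* Write theta for an angle of a triangle, N = cot^2 (theta / 2), and use the
   coordinates p = 1/r in the Euclidean case, p = 1/sinh r in the hyperbolic one.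
   With d_i = sqrt (p_i^2 + s^2), where s = 0 (Euclidean) or s = 1 (hyperbolic),
   the angle at the corner i of a triangle (i, j, k) satisfies
     N_i = (d_i d_j + d_j d_k + d_k d_i + s^2) / p_i^2.
   So both geometries belong to one family of curvature maps K_s, in which
   K_s (a p) = K_(s / a) (p), K_s decreases strictly with s, and N_i increases
   with p_j and p_k, which makes maximum principle arguments possible.
   - Closedness. If lambda <= -1, each corner contributes at most 1 to the
     curvature and tends to -oo when N does, so a lower bound on the curvatures
     bounds N, hence all the quotients p_j / p_i and s / p_i. Up to rescaling,
     (s, p) then stays in a compact set: the values of K_s for s = 0 and those for
     all s >= 0 form closed sets, namely the Euclidean image and its union with
     the hyperbolic one.
   - Openness of the hyperbolic image. As K_1 (2 p) > K_1 (p) > K_1 (p / 2), the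
     values near K_1 (p) are attained between p / 2 and 2 p by Perron's method.
   - Submanifold. Put x = log p and H (x) = K_0 (exp x) + x_v0 e_v0 for a fixed
     vertex v0. By the maximum principle H is injective with invertible
     differential, and its image is open by Perron's method again; the
     Euclidean image is H ({x_v0 = 0}), so H^-1 is a global chart. *)
Require Import Defs.
From mathcomp Require Import all_boot all_order all_algebra.
From mathcomp Require Import all_classical all_reals all_analysis.
From mathcomp Require Import ring lra.

Set Implicit Arguments.
Unset Strict Implicit.
Unset Printing Implicit Defensive.

Import Order.TTheory GRing.Theory Num.Theory.
Import numFieldNormedType.Exports.
Local Open Scope classical_set_scope.
Local Open Scope ring_scope.

(** * The contribution of a corner to the curvature *)

Section AngleIntegral.
Variables (R : realType) (f : R -> R).
Hypothesis f_cont : forall x : R, 0 < x < pi -> {for x, continuous f}.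

Lemma integrable_itv (a b : R) : 0 < a -> b < pi ->
  (@lebesgue_measure R).-integrable `[a, b] (EFin \o f).
Proof.
move=> a0 bpi; apply: continuous_compact_integrable.
  exact: segment_compact.
apply: continuous_in_subspaceT => x; rewrite inE/= in_itv/= => /andP[ax xb].
by apply: f_cont; rewrite (lt_le_trans a0)//= (le_lt_trans xb).
Qed.

(** A base point below both [c] and [x] removes the case distinction of [oriented_integral], so that
    the fundamental theorem of calculus applies on either side of [c]. *)
Lemma oriented_integralE (a c x : R) : 0 < a -> a < c -> c < pi -> a < x ->
    x < pi ->
  oriented_integral f c x =
    \int[lebesgue_measure]_(t in `[a, x]) f t
      - \int[lebesgue_measure]_(t in `[a, c]) f t.
Proof.
move=> a0 ac cpi ax xpi.
have chasles u v : a < u -> u <= v -> v < pi ->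
    \int[lebesgue_measure]_(t in `[a, v]) f t
      - \int[lebesgue_measure]_(t in `[a, u]) f t =
    \int[lebesgue_measure]_(t in `[u, v]) f t.
  move=> au uv vpi; rewrite Rintegral_itvB ?bnd_simp//; last 2 first.
  - exact: integrable_itv.
  - exact: ltW.
  rewrite Rintegral_itv_obnd_cbnd//.
  apply: integrableS (integrable_itv (lt_trans a0 au) vpi) => //.
  by apply: subset_itvr; rewrite bnd_simp.
rewrite /oriented_integral; case: ifPn => [cx|]; first by rewrite chasles.
by rewrite -ltNge => /ltW xc; rewrite -(chasles x c)// opprB.
Qed.

Lemma is_derive_oriented_integral (c x : R) : 0 < c < pi -> 0 < x < pi ->
  is_derive x 1 (oriented_integral f c) (f x).
Proof.
move=> /andP[c0 cpi] /andP[x0 xpi].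
pose a := Num.min c x / 2.
have m0 : 0 < Num.min c x by rewrite lt_min c0.
have a0 : 0 < a by rewrite divr_gt0.
have am : a < Num.min c x by rewrite /a ltr_pdivrMr// ltr_pMr// ltr1n.
have ac : a < c by rewrite (lt_le_trans am)// ge_min lexx.
have ax : a < x by rewrite (lt_le_trans am)// ge_min lexx orbT.
pose u := (x + pi) / 2.
have xu : x < u by rewrite /u; lra.
have upi : u < pi by rewrite /u; lra.
have [dF F'] := continuous_FTC1_closed xu (integrable_itv a0 upi) ax
  (f_cont (introT andP (conj x0 xpi))).
apply: (@near_eq_is_derive _ _ _ (fun y =>
   \int[lebesgue_measure]_(t in `[a, y]) f t
      - \int[lebesgue_measure]_(t in `[a, c]) f t)).
  near=> y; rewrite (@oriented_integralE a)//.
    by near: y; exact: lt_nbhsr.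
  by near: y; exact: lt_nbhsl.
rewrite -[f x]subr0; apply: is_deriveB.
by rewrite -F' derive1E; exact/derivableP.
Unshelve. all: by end_near. Qed.

End AngleIntegral.

(** * Corner contributions as functions of N = cot^2 (theta / 2) *)

Section CornerTerm.
Variables (R : realType) (lambda : R).

(* The contribution of an angle theta such that N = cot^2 (theta / 2). *)
Definition corner_term (N : R) : R :=
  oriented_integral (fun t => tan (t / 2) `^ lambda) (pi / 2)
    (acos ((N - 1) / (N + 1))).

(** The derivative of [corner_term]: with t = tan (theta / 2) = N^(-1/2), the integrand at theta is
    t^lambda, and d theta / dN = - t / (1 + N). *)
Definition corner_term' (N : R) : R := - (N `^ (- (1 + lambda) / 2) / (1 + N)).

Lemma sqr_powRN2 (N : R) : 0 < N -> (N `^ (- 2^-1)) ^+ 2 = N^-1.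
Proof.
move=> N0; rewrite -powR_mulrn ?powR_ge0// -powRrM mulNr mulVf// powR_inv1//.
exact: ltW.
Qed.

(** This is cos (2 atan t) = (1 - t^2) / (1 + t^2) at t^2 = 1 / N. *)
Lemma acos_atan (N : R) : 0 < N ->
  acos ((N - 1) / (N + 1)) = 2 * atan (N `^ (- 2^-1)).
Proof.
move=> N0; set t := N `^ _.
have t0 : 0 < t by exact: powR_gt0.
have tt : t ^+ 2 = N^-1 by exact: sqr_powRN2.
have aP : 0 <= atan t by rewrite -atan0 le_atan// ltW.
rewrite -[RHS]cosK; last first.
  by rewrite in_itv/= mulr_ge0//=; have := atan_ltpi2 t; lra.
congr acos; rewrite mulr_natl cos_mulr2n cos_atan tt exprVn sqr_sqrtr; last first.
  by rewrite addr_ge0// invr_ge0 ltW.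
by field; rewrite ?gt_eqF ?addr_gt0//.
Qed.

Lemma is_derive_corner_term (N : R) : 0 < N ->
  is_derive N 1 corner_term (corner_term' N).
Proof.
move=> N0.
pose g t : R := tan (t / 2) `^ lambda.
have gc : forall x : R, 0 < x < pi -> {for x, continuous g}.
  move=> x /andP[x0 xpi].
  have c0 : 0 < cos (x / 2) by apply: cos_gt0_pihalf; have := @pi_gt0 R; lra.
  have s0 : 0 < sin (x / 2) by apply: sin_gt0_pihalf; lra.
  have ct : {for x, continuous (fun y : R => tan (y / 2))}.
    apply: (@continuous_comp _ _ _ (fun y : R => y / 2) tan).
      exact: mulrr_continuous.
    by apply: continuous_tan; rewrite gt_eqF.
  have cp : {for tan (x / 2), continuous (fun y : R => y `^ lambda)}.
    apply: differentiable_continuous; apply/derivable1_diffP.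
    by apply: derivable_powR; rewrite in_itv/= andbT /tan divr_gt0.
  exact: continuous_comp ct cp.
apply: (@near_eq_is_derive _ _ _ (fun M : R =>
    oriented_integral g (pi / 2) (2 * atan (M `^ (- 2^-1))))).
  near=> M; rewrite /corner_term acos_atan//.
  by near: M; exact: lt_nbhsr.
pose th (M : R) : R := 2 * atan (M `^ (- 2^-1)).
set t := N `^ (- 2^-1).
have t0 : 0 < t by exact: powR_gt0.
have tt : t ^+ 2 = N^-1 by exact: sqr_powRN2.
have a0 : 0 < atan t by rewrite -atan0 lt_atan.
have dF : is_derive (th N) 1 (oriented_integral g (pi / 2)) (g (th N)).
  apply: is_derive_oriented_integral => //; first by have := @pi_gt0 R; lra.
  by rewrite /th -/t; have := atan_ltpi2 t; lra.
have dth : is_derive N 1 th (- (t / (1 + N))).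
  have dp := is_derive1_powR (- 2^-1) N0.
  have d2 := is_deriveZ 2 (@is_derive1_comp _ atan
    (fun M : R => M `^ (- 2^-1)) N _ _ (is_derive1_atan t) dp).
  apply: (is_derive_eq d2).
  rewrite powRB; last by apply/implyP => _; rewrite gt_eqF.
  rewrite powRr1 ?(ltW N0)// -/t tt /GRing.scale/=.
  by field; rewrite ?gt_eqF ?addr_gt0//.
apply: (is_derive_eq (is_derive1_comp dF dth)).
rewrite /corner_term' /g /th -/t mulrAC mulfV// mul1r atanK.
have -> : - (1 + lambda) / 2 = - 2^-1 * lambda + - 2^-1 by lra.
rewrite powRD; last by apply/implyP => _; rewrite gt_eqF.
by rewrite powRrM -/t mulrN mulrA.
Unshelve. all: by end_near. Qed.

Lemma corner_term1 : corner_term 1 = 0.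
Proof.
rewrite /corner_term subrr mul0r acos0 /oriented_integral lexx set_itv1.
exact: Rintegral_set1.
Qed.

Lemma continuous_corner_term (N : R) : 0 < N -> {for N, continuous corner_term}.
Proof.
move=> N0; apply: differentiable_continuous; apply/derivable1_diffP.
by have [] := is_derive_corner_term N0.
Qed.

Lemma mean_value (f df : R -> R) (a b : R) : a <= b ->
    (forall x, a <= x <= b -> is_derive x 1 f (df x)) ->
  exists2 c, a <= c <= b & f b - f a = df c * (b - a).
Proof.
move=> ab fdf; have [c||c] := @MVT_segment R f df a b ab.
- by rewrite in_itv/= => /andP[ac cb]; apply: fdf; rewrite !ltW.
- apply: continuous_in_subspaceT => x; rewrite inE/= in_itv/= => xab.
  apply: differentiable_continuous; apply/derivable1_diffP.
  by have [] := fdf x xab.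
- by rewrite in_itv/= => cab fE; exists c.
Qed.

Lemma corner_term'_lt0 (N : R) : 0 < N -> corner_term' N < 0.
Proof. by move=> N0; rewrite oppr_lt0 divr_gt0 ?powR_gt0// addr_gt0. Qed.

Lemma corner_term_lt (M N : R) : 0 < M -> M < N ->
  corner_term N < corner_term M.
Proof.
move=> M0 MN; rewrite -subr_lt0.
have [c|c /andP[Mc _] ->] :=
    mean_value (f := corner_term) (df := corner_term') (ltW MN).
  by move=> /andP[Mc _]; apply: is_derive_corner_term; exact: lt_le_trans Mc.
by rewrite pmulr_llt0 ?subr_gt0// corner_term'_lt0// (lt_le_trans M0).
Qed.

Lemma corner_term_le (M N : R) : 0 < M -> M <= N ->
  corner_term N <= corner_term M.
Proof.
move=> M0; rewrite le_eqVlt => /predU1P[->//|MN].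
by rewrite ltW// corner_term_lt.
Qed.

Hypothesis lambda_leN1 : lambda <= -1.

(** The term vanishes at 1 and decreases, which settles N >= 1. On ]0, 1] its derivative has
    absolute value at most 1, since [lambda <= -1] makes the exponent in [corner_term']
    nonnegative. *)
Lemma corner_term_le1 (N : R) : 0 < N -> corner_term N <= 1.
Proof.
move=> N0; have [N1|N1] := leP 1 N.
  by apply: (le_trans (corner_term_le ltr01 N1)); rewrite corner_term1.
have [c /andP[Nc _]|c /andP[Nc c1]] :=
    mean_value (f := corner_term) (df := corner_term') (ltW N1).
  by apply: is_derive_corner_term; exact: lt_le_trans Nc.
rewrite corner_term1 sub0r => /(congr1 -%R); rewrite opprK => ->.
have c0 : 0 < c := lt_le_trans N0 Nc.
rewrite -mulNr opprK mulr_ile1//; last by rewrite ler_wnDr// oppr_le0 ltW.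
- by rewrite divr_ge0 ?powR_ge0// addr_ge0// ltW.
- by rewrite subr_ge0 ltW.
rewrite ler_pdivrMr ?addr_gt0// mul1r.
apply: (@le_trans _ _ 1); last by rewrite lerDl ltW.
have a0 : 0 <= - (1 + lambda) / 2.
  by rewrite divr_ge0// oppr_ge0 addrC -lerBrDr sub0r.
by have := @ger_powR _ c (introT andP (conj c0 c1)) _ _ a0; rewrite powRr0.
Qed.

(** For c >= 1 the power in [corner_term'] is at least 1, so the derivative is at most - 1 / (1 + c)
    <= - 1 / (2 c). Hence the contribution tends to -oo as N grows. *)
Lemma corner_term_le_ln (N : R) : 1 <= N -> corner_term N <= - (ln N / 2).
Proof.
move=> N1; rewrite -subr_le0 opprK.
pose h x := corner_term x + ln x / 2.
have [c|c /andP[c1 _]] :=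
    mean_value (f := h) (df := fun x => corner_term' x + x^-1 / 2) N1.
  move=> /andP[c1 _]; have c0 : 0 < c := lt_le_trans ltr01 c1.
  apply: is_deriveD; first exact: is_derive_corner_term.
  have := is_deriveZ 2^-1 (is_derive1_ln c0).
  rewrite [_ *: _]mulrC.
  by congr is_derive; apply/funext => x; rewrite /GRing.scale/= mulrC.
have c0 : 0 < c := lt_le_trans ltr01 c1.
rewrite /h corner_term1 ln1 mul0r addr0 subr0 => ->.
rewrite mulr_le0_ge0 ?subr_ge0// /corner_term'.
rewrite addrC subr_le0 -invfM.
apply: (@le_trans _ _ (1 / (1 + c))).
  by rewrite mul1r lef_pV2 ?posrE; lra.
rewrite ler_pM2r ?invr_gt0 ?addr_gt0//.
have a0 : 0 <= - (1 + lambda) / 2.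
  by rewrite divr_ge0// oppr_ge0 addrC -lerBrDr sub0r.
by have := @ler_powR _ c c1 _ _ a0; rewrite powRr0.
Qed.

Lemma corner_term_ge (C N : R) : 0 <= C -> 0 < N -> - C <= corner_term N ->
  N <= expR (2 * C).
Proof.
move=> C0 N0 hC; have [N1|/ltW N1] := leP N 1.
  by rewrite (le_trans N1)// -expR0 ler_expR mulr_ge0.
rewrite -[N]lnK ?posrE// ler_expR.
by have := corner_term_le_ln N1; lra.
Qed.

End CornerTerm.

(** * Smooth functions on R^n *)

Section Smooth.
Variables (R : realType) (n : nat).
Implicit Types (f g : 'rV[R]_n -> R) (v x : 'rV[R]_n).

Lemma is_derive_coord x v i : is_derive x v (fun y : 'rV[R]_n => y 0 i) (v 0 i).
Proof.
have dc := @differentiable_coord R 1 n x 0 i.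
apply: DeriveDef; first exact: diff_derivable.
have := @derive_mx R _ 1 n id x v (@derivable_id _ _ x v).
by rewrite derive_id => /matrixP/(_ 0 i); rewrite mxE.
Qed.

(* The last constructor lets in functions defined by integrals; closure under
   directional derivatives, the content of [smoothP], is then an induction. *)
Inductive smooth : ('rV[R]_n -> R) -> Prop :=
| smooth_cst c : smooth (fun=> c)
| smooth_coord i : smooth (fun x => x 0 i)
| smoothD f g : smooth f -> smooth g -> smooth (fun x => f x + g x)
| smoothM f g : smooth f -> smooth g -> smooth (fun x => f x * g x)
| smoothV f : smooth f -> (forall x, f x != 0) -> smooth (fun x => (f x)^-1)
| smooth_exp f : smooth f -> smooth (fun x => expR (f x))
| smooth_powR f a : smooth f -> (forall x, 0 < f x) ->
    smooth (fun x => f x `^ a)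
| smooth_derive f : (forall x, differentiable f x) ->
    (forall v, smooth ('D_v f)) -> smooth f.

Lemma differentiable_comp1 (h : R -> R) f x dh : differentiable f x ->
    is_derive (f x) 1 h dh ->
  differentiable (h \o f) x /\ forall v, 'D_v (h \o f) x = dh * 'D_v f x.
Proof.
move=> df [/derivable1_diffP dhf hE].
split; first exact: differentiable_comp.
move=> v; rewrite deriveE; last exact: differentiable_comp.
rewrite diff_comp//= (deriveE v df) -[X in 'd h _ X]mulr1 linearZ/=.
by rewrite -hE deriveE// mulrC.
Qed.

Lemma smoothP f : smooth f ->
  (forall x, differentiable f x) /\ (forall v, smooth ('D_v f)).
Proof.
elim=> {f}.
- move=> c; split=> [x|v]; first exact: differentiable_cst.
  rewrite (_ : 'D_v _ = fun=> 0); first exact: smooth_cst.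
  by apply/funext => x; rewrite derive_cst.
- move=> i; have dc x := @differentiable_coord R 1 n x 0 i.
  split=> // v; rewrite (_ : 'D_v _ = fun=> v 0 i); first exact: smooth_cst.
  by apply/funext => x; have [_ ->] := is_derive_coord x v i.
- move=> f g sf [df Df] sg [dg Dg]; split=> [x|v].
    exact: (@differentiableD R _ _ f g).
  rewrite (_ : 'D_v _ = fun x => 'D_v f x + 'D_v g x); first exact: smoothD.
  by apply/funext => x; rewrite (@deriveD R _ _ f g)//; exact: diff_derivable.
- move=> f g sf [df Df] sg [dg Dg]; split=> [x|v].
    exact: (@differentiableM R _ f g).
  rewrite (_ : 'D_v _ = fun x => f x * 'D_v g x + g x * 'D_v f x).
    by apply: smoothD; exact: smoothM.
  by apply/funext => x; rewrite (@deriveM R _ f g)//; exact: diff_derivable.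
- move=> f sf [df Df] f0; split=> [x|v]; first exact: (@differentiableV R _ f).
  rewrite (_ : 'D_v _ = fun x => (- 1) * ((f x)^-1 * (f x)^-1) * 'D_v f x).
    apply: smoothM => //; apply: smoothM; first exact: smooth_cst.
    by apply: smoothM; exact: smoothV.
  apply/funext => x; rewrite (@deriveV R _ f)//; last exact: diff_derivable.
  by rewrite /GRing.scale/= -exprVn mulN1r expr2.
- move=> f sf [df Df].
  have dE x := differentiable_comp1 (df x) (is_derive_expR (f x)).
  split=> [x|v]; first by have [] := dE x.
  rewrite (_ : 'D_v _ = fun x => expR (f x) * 'D_v f x).
    by apply: smoothM => //; exact: smooth_exp.
  by apply/funext => x; have [_ <-] := dE x.
- move=> f a sf [df Df] f0.
  have dE x := @differentiable_comp1 (fun y => y `^ a) f x _ (df x)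
    (is_derive1_powR a (f0 x)).
  split=> [x|v]; first by have [] := dE x.
  rewrite (_ : 'D_v _ = fun x => a * f x `^ (a - 1) * 'D_v f x).
    apply: smoothM => //; apply: smoothM; first exact: smooth_cst.
    exact: smooth_powR.
  by apply/funext => x; have [_ <-] := dE x.
- by move=> f df Df _; split.
Qed.

(** Brings in [corner_term], an integral whose derivative is elementary. *)
Lemma smooth_comp (h h' : R -> R) f : smooth f ->
    (forall x, is_derive (f x) 1 h (h' (f x))) ->
  smooth (h' \o f) -> smooth (h \o f).
Proof.
move=> sf hf sh'; have [df Df] := smoothP sf.
have dE x := differentiable_comp1 (df x) (hf x).
apply: smooth_derive => [x|v]; first by have [] := dE x.
rewrite (_ : 'D_v _ = fun x => (h' \o f) x * 'D_v f x); first exact: smoothM.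
by apply/funext => x; have [_ ->] := dE x.
Qed.

Lemma smoothN f : smooth f -> smooth (fun x => - f x).
Proof.
move=> sf; rewrite (_ : (fun _ => _) = fun x => (-1) * f x).
  by apply: smoothM => //; exact: smooth_cst.
by apply/funext => x; rewrite mulN1r.
Qed.

Lemma smooth_sum (I : Type) (r : seq I) (P : pred I) (F : I -> 'rV[R]_n -> R) :
  (forall i, P i -> smooth (F i)) -> smooth (fun x => \sum_(i <- r | P i) F i x).
Proof.
move=> sF; elim: r => [|i r IH].
  rewrite (_ : (fun _ => _) = fun=> 0); first exact: smooth_cst.
  by apply/funext => x; rewrite big_nil.
have [Pi|nPi] := boolP (P i).
  rewrite (_ : (fun _ => _) = fun x => F i x + \sum_(j <- r | P j) F j x).
    by apply: smoothD => //; exact: sF.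
  by apply/funext => x; rewrite big_cons Pi.
rewrite (_ : (fun _ => _) = fun x => \sum_(j <- r | P j) F j x)//.
by apply/funext => x; rewrite big_cons (negbTE nPi).
Qed.

Lemma smooth_prod (I : Type) (r : seq I) (F : I -> 'rV[R]_n -> R) :
  (forall i, smooth (F i)) -> smooth (fun x => \prod_(i <- r) F i x).
Proof.
move=> sF; elim: r => [|i r IH].
  rewrite (_ : (fun _ => _) = fun=> 1); first exact: smooth_cst.
  by apply/funext => x; rewrite big_nil.
rewrite (_ : (fun _ => _) = fun x => F i x * \prod_(j <- r) F j x).
  exact: smoothM.
by apply/funext => x; rewrite big_cons.
Qed.

Lemma smooth_det m (A : 'rV[R]_n -> 'M[R]_m) :
  (forall i j, smooth (fun x => A x i j)) -> smooth (fun x => \det (A x)).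
Proof.
move=> sA; apply: smooth_sum => s _; apply: smoothM; first exact: smooth_cst.
exact: smooth_prod.
Qed.

(** By Cramer's rule the entries are cofactors divided by the determinant. *)
Lemma smooth_invmx m (A : 'rV[R]_n -> 'M[R]_m) :
    (forall i j, smooth (fun x => A x i j)) -> (forall x, A x \in unitmx) ->
  forall i j, smooth (fun x => invmx (A x) i j).
Proof.
move=> sA uA i j.
rewrite (_ : (fun _ => _) = fun x => (\det (A x))^-1 * cofactor (A x) j i).
  apply: smoothM.
    apply: smoothV; first exact: smooth_det.
    by move=> x; rewrite -unitfE; exact: uA.
  apply: smoothM; first exact: smooth_cst.
  apply: smooth_det => k l.
  rewrite (_ : (fun _ => _) = fun x => A x (lift j k) (lift i l))//.
  by apply/funext => x; rewrite !mxE.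
by apply/funext => x; rewrite /invmx uA !mxE.
Qed.

End Smooth.

(** * Smooth maps between coordinate spaces *)

Section SmoothMaps.
Variables (R : realType) (m n : nat).
Implicit Types (F : 'rV[R]_m -> 'rV[R]_n).

Lemma cvg_row (T : Type) (A : set_system T) (FA : Filter A)
    (f : T -> 'rV[R]_n) (l : 'rV[R]_n) :
  (forall i, f t 0 i @[t --> A] --> l 0 i) -> f t @[t --> A] --> l.
Proof.
move=> fl; apply/cvgrPdist_lt => e e0.
have near_all : \forall t \near A, forall j, `|l 0 j - f t 0 j| < e.
  by apply: filter_forall => j; have /cvgrPdist_lt/(_ _ e0) := fl j; exact.
near=> t.
rewrite [ltLHS]/Num.Def.normr/= mx_normrE; apply/bigmax_ltP; split=> // -[i j] _.
by rewrite !mxE/= (ord1 i); move: j; near: t.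
Unshelve. all: by end_near. Qed.

Lemma continuous_row F (x : 'rV[R]_m) :
  (forall i, {for x, continuous (fun y => F y 0 i)}) -> {for x, continuous F}.
Proof. by move=> cF; apply: (cvg_row (nbhs_filter x)) => i; exact: cF. Qed.

(** Since directional derivatives stay in the class [P], continuity of the derivatives of all orders
    follows by induction on the order. *)
Lemma smooth_on_ind (U : set 'rV[R]_m) (P : ('rV[R]_m -> 'rV[R]_n) -> Prop) :
    (forall F, P F -> forall x, U x -> {for x, continuous F}) ->
    (forall F, P F -> forall v, (forall x, U x -> derivable F x v) /\
       exists2 G, P G & forall x, U x -> 'D_v F x = G x) -> open U ->
  forall F, P F -> smooth_on U F.
Proof.
move=> Pc Pd oU F PF k.
(* ['D_v F] is known only on [U], so the induction ranges over the maps that agree there with a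
   member of [P]. *)
have : exists2 G, P G & forall x, U x -> F x = G x by exists F.
elim: k F {PF} => [|k IH] F [G PG FG].
all: have FGn x : U x -> \forall y \near x, G y = F y.
  1,3: by move=> Ux; near=> y; rewrite FG//; near: y; exact: open_nbhs_nbhs.
all: have cF x : U x -> {for x, continuous F}.
  1,3: move=> Ux; have Gc : G y @[y --> x] --> G x by exact: Pc.
  1,2: suff : F y @[y --> x] --> F x by [].
  1,2: rewrite FG//; apply: cvg_trans Gc.
  1,2: exact: (@near_eq_cvg _ _ _ (nbhs_filter x) G F (FGn _ Ux)).
all: split=> // v.
have [dG [G' PG' GG']] := Pd _ PG v; split=> [x Ux|].
  by apply: near_eq_derivable (dG x Ux); exact: FGn.
apply: IH; exists G' => // x Ux; rewrite -GG'//.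
by apply: near_eq_derive; near=> y; apply/esym; near: y; exact: FGn.
Unshelve. all: by end_near. Qed.

Lemma smooth_onT F : (forall i, smooth (fun x => F x 0 i)) -> smooth_on setT F.
Proof.
apply: (smooth_on_ind (P := fun F => forall i, smooth (fun x => F x 0 i))).
- move=> {}F sF x _; apply: continuous_row => i.
  by apply: differentiable_continuous; have [] := smoothP (sF i).
- move=> {}F sF v.
  have dF x : derivable F x v.
    apply/derivable_mxP => i j; rewrite (ord1 i); apply: diff_derivable.
    by have [] := smoothP (sF j).
  split=> //; exists ('D_v F) => // i; have [_ /(_ v)] := smoothP (sF i).
  by congr smooth; apply/funext => x; rewrite derive_mx// mxE.
- exact: openT.
Qed.

End SmoothMaps.

(** * Smoothness of a continuous inverse of a map with invertible differential *)

Section InverseMap.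
Variables (R : realType) (n : nat).

Lemma differentiable_row (m : nat) (F : 'rV[R]_m -> 'rV[R]_n) (x : 'rV[R]_m) :
  (forall i, differentiable (fun y => F y 0 i) x) -> differentiable F x.
Proof.
move=> dF.
have -> : F = \sum_(i < n) (fun y => F y 0 i *: delta_mx 0 i).
  by apply/funext => y; rewrite fct_sumE; exact: row_sum_delta.
by apply: differentiable_sum => i; exact: differentiableZl.
Qed.

Lemma continuous_mulmxr (m : nat) (B : 'M[R]_(m, n)) :
  continuous (fun v : 'rV[R]_m => v *m B).
Proof.
move=> v; apply: continuous_row => i; apply: differentiable_continuous.
suff /smoothP[] : smooth (fun w : 'rV[R]_m => (w *m B) 0 i) by [].
have -> : (fun w : 'rV[R]_m => (w *m B) 0 i) = fun w => \sum_j w 0 j * B j i.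
  by apply/funext => w; rewrite mxE.
apply: smooth_sum => j _; apply: smoothM; first exact: smooth_coord.
exact: smooth_cst.
Qed.

Lemma diff_epsP (V W : normedModType R) (f : V -> W) (x : V)
    (df : {linear V -> W}) :
    continuous df ->
    (forall e, 0 < e -> \forall h \near 0,
      `|f (h + x) - (f x + df h)| <= e * `|h|) ->
  differentiable f x /\ 'd f x = df :> (V -> W).
Proof.
move=> cdf hf.
have fE : f \o shift x = cst (f x) + df +o_ 0 id by apply/eqaddoP.
have dfE := diff_unique cdf fE.
by split=> //; apply/diff_locallyP; rewrite dfE.
Qed.

Variables (H phi : 'rV[R]_n -> 'rV[R]_n) (U : set 'rV[R]_n).
Hypothesis dH : forall x : 'rV[R]_n, differentiable H x.
Hypothesis uH : forall x : 'rV[R]_n, jacobian H x \in unitmx.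
Hypothesis oU : open U.
Hypothesis phiK : forall y, U y -> H (phi y) = y.
Hypothesis cphi : forall y, U y -> {for y, continuous phi}.

(** Let J be the Jacobian of [H] at [phi y], B its inverse and d = phi (h + y) - phi y, which tends
    to 0 by continuity. Differentiability of [H] gives h - d J = o(d); multiplying by B, d - h B =
    o(d). Then d = O(h), so the error is o(h). *)
Lemma diff_inverse (y v : 'rV[R]_n) : U y ->
  differentiable phi y /\ 'd phi y v = v *m invmx (jacobian H (phi y)).
Proof.
move=> Uy; set B := invmx _.
have cB := @continuous_mulmxr n B.
have cB' : continuous (mulmxr B : {linear 'rV[R]_n -> 'rV[R]_n}) by exact: cB.
suff h : forall e : R, 0 < e -> \forall h \near (0 : 'rV[R]_n),
    `|phi (h + y) - (phi y + mulmxr B h)| <= e * `|h|.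
  by have [? ->] := diff_epsP cB' h.
have [k k0 kB] := linear_lipschitz cB'.
(* The first bound lets half of [|d|] absorb the error, whence [|d| <= 2 * k * |h|]; with the second
   one the error [k * e' * |d|] is at most [e * |h|]. *)
move=> e e0; pose e' := Num.min (2 * k)^-1 (e / (2 * k ^+ 2)).
have e'0 : 0 < e'.
  by rewrite lt_min invr_gt0 divr_gt0// ?mulr_gt0// exprn_gt0.
have /diff_locally/eqaddoP/(_ _ e'0) := dH (phi y).
have c1 : h + y @[h --> (0 : 'rV[R]_n)] --> y.
  rewrite -[X in _ --> X]add0r.
  apply: (@cvgD _ _ _ _ (nbhs_filter _) id (fun=> y) 0 y); first exact: cvg_id.
  exact: cvg_cst.
have c2 : phi (h + y) @[h --> (0 : 'rV[R]_n)] --> phi y :=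
  cvg_comp _ _ c1 (cphi Uy).
have cphi0 : phi (h + y) - phi y @[h --> (0 : 'rV[R]_n)] --> (0 : 'rV[R]_n).
  have c3 := @cvgB _ _ _ _ _ _ (fun=> phi y) _ _ c2 (cvg_cst (phi y)).
  by have := c3 (nbhs_filter _); rewrite subrr; exact.
have nU : \forall h \near (0 : 'rV[R]_n), U (h + y).
  by apply: c1; exact: open_nbhs_nbhs.
move=> /cphi0 /= H1.
near=> h.
have Uhy : U (h + y) by near: h.
have : `|H (phi (h + y) - phi y + phi y) -
          (H (phi y) + 'd H (phi y) (phi (h + y) - phi y))|
   <= e' * `|phi (h + y) - phi y| by near: h; exact: H1.
set d := phi (h + y) - phi y.
rewrite subrK !phiK// opprD addrA addrK.
have -> : 'd H (phi y) d = d *m jacobian H (phi y).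
  by rewrite /jacobian mul_rV_lin1.
set J := jacobian _ _ => hd.
have dE : d - h *m B = - ((h - d *m J) *m B).
  by rewrite mulmxBl (mulmxK (uH _)) opprB.
have le1 : `|d - h *m B| <= k * (e' * `|d|).
  by rewrite dE normrN (le_trans (kB _))// ler_wpM2l// ltW.
have le2 : `|d| <= 2 * k * `|h|.
  have : `|d| <= `|d - h *m B| + `|h *m B|.
    by rewrite -{1}[d](subrK (h *m B)) ler_normD.
  have := kB h; rewrite /=.
  have : k * (e' * `|d|) <= `|d| / 2.
    rewrite mulrA mulrC ler_wpM2l//.
    apply: (@le_trans _ _ (k * (2 * k)^-1)).
      by rewrite ler_wpM2l ?(ltW k0)// /e' ge_min lexx.
    by rewrite invfM mulrCA mulfV ?mulr1 ?gt_eqF.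
  lra.
rewrite opprD addrA -/d /=; apply: (le_trans le1).
apply: (@le_trans _ _ (k * (e' * (2 * k * `|h|)))).
  by rewrite !ler_wpM2l// ltW.
rewrite !mulrA ler_wpM2r//.
apply: (@le_trans _ _ (k * (e / (2 * k ^+ 2)) * 2 * k)).
  by rewrite !ler_wpM2r ?(ltW k0)// ler_wpM2l ?(ltW k0)// /e' ge_min lexx orbT.
by rewrite le_eqVlt; apply/orP; left; apply/eqP; field; rewrite gt_eqF.
Unshelve. all: by end_near. Qed.

(* The maps G \o phi with G smooth are stable under derivation, because
   'D_v (G \o phi) = (x |-> v * (dH x)^-1 * dG x) \o phi. *)
Lemma smooth_on_inverse : (forall i, smooth (fun x => H x 0 i)) ->
  smooth_on U phi.
Proof.
move=> sH.
pose P (F : 'rV[R]_n -> 'rV[R]_n) := exists2 G : 'rV[R]_n -> 'rV[R]_n,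
  (forall i, smooth (fun x => G x 0 i)) & F = G \o phi.
have dG (G : 'rV[R]_n -> 'rV[R]_n) x :
    (forall i, smooth (fun x => G x 0 i)) -> differentiable G x.
  by move=> sG; apply: differentiable_row => i; have [] := smoothP (sG i).
apply: (smooth_on_ind (P := P)) => //.
- move=> _ [G sG ->] y Uy; apply: differentiable_continuous.
  by apply: differentiable_comp; [exact: (diff_inverse 0 Uy).1|exact: dG].
- move=> _ [G sG ->] v; split=> [y Uy|].
    apply: diff_derivable.
    by apply: differentiable_comp; [exact: (diff_inverse 0 Uy).1|exact: dG].
  exists ((fun x => v *m invmx (jacobian H x) *m jacobian G x) \o phi).
    eexists; last by [].
    have sJ (G' : 'rV[R]_n -> 'rV[R]_n) i j :
        (forall i, smooth (fun x => G' x 0 i)) ->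
        smooth (fun x => jacobian G' x i j).
      move=> sG'; have [_ /(_ (delta_mx 0 i))] := smoothP (sG' j).
      congr smooth; apply/funext => x.
      have := deriveEjacobian (delta_mx 0 i) (dG _ x sG').
      rewrite -rowE derive_mx; last exact/diff_derivable/dG.
      by move=> /matrixP/(_ 0 j); rewrite !mxE.
    move=> j; rewrite (_ : (fun _ => _) = fun x => \sum_k
       (\sum_l v 0 l * invmx (jacobian H x) l k) * jacobian G x k j).
      apply: smooth_sum => k _; apply: smoothM; last exact: sJ.
      apply: smooth_sum => l _; apply: smoothM; first exact: smooth_cst.
      by apply: smooth_invmx => // a b; exact: sJ.
    apply/funext => x; rewrite mxE; apply: eq_bigr => k _.
    by rewrite mxE.
  move=> y Uy; have [dphi phi'] := diff_inverse v Uy.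
  have dGy : differentiable G (phi y) by exact: dG.
  rewrite deriveE; last exact: differentiable_comp.
  rewrite diff_comp//=.
  apply: (etrans (congr1 ('d G (phi y)) phi')).
  by rewrite [in RHS]/jacobian mul_rV_lin1.
(* [phi] itself is in the class, with the identity as [G]. *)
- exists id => // i; exact: smooth_coord.
Qed.

End InverseMap.

(** * Perron's method *)

Section Perron.
Variables (R : realType) (n : nat) (K : 'rV[R]_n -> 'rV[R]_n).
Hypothesis K_cont : forall i, continuous (fun x : 'rV[R]_n => K x 0 i).
Hypothesis K_mono : forall (x y : 'rV[R]_n) i, (forall j, x 0 j <= y 0 j) ->
  x 0 i = y 0 i -> K y 0 i <= K x 0 i.

(* A solution of K x = k is a point of the box [a, b] that maximizes the sum of
   the coordinates among those with K x <= k: if K x 0 i < k 0 i, then the i-th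
   coordinate can be increased, which decreases the other components of K. *)
Lemma perron (a b k : 'rV[R]_n) : (forall i, a 0 i <= b 0 i) ->
    (forall i, K a 0 i < k 0 i) -> (forall i, k 0 i < K b 0 i) ->
  exists2 x : 'rV[R]_n, (forall i, a 0 i <= x 0 i <= b 0 i) & K x = k.
Proof.
move=> ab Ka Kb.
pose box := [set x : 'rV[R]_n | forall i, `[a 0 i, b 0 i]%classic (x 0 i)].
pose sub := [set x : 'rV[R]_n | forall i, K x 0 i <= k 0 i].
have cbox : compact box.
  apply: (@rV_compact _ n (fun i => `[a 0 i, b 0 i]%classic)) => i.
  exact: segment_compact.
have csub : closed sub.
  rewrite (_ : sub = \bigcap_i [set x | K x 0 i <= k 0 i]).
    apply: closed_bigI => i _.
    apply: (@preimage_closed _ _ (fun x => K x 0 i) [set y | y <= k 0 i]).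
      by move=> x _; exact: K_cont.
    exact: closed_le.
  by apply/seteqP; split => x /= => [h i _|h i]; exact: h.
pose f (x : 'rV[R]_n) := \sum_i x 0 i.
have cf : {within box `&` sub, continuous f}.
  apply: continuous_in_subspaceT => x _; apply: differentiable_continuous.
  suff /smoothP[] : smooth f by [].
  by apply: smooth_sum => i _; exact: smooth_coord.
have [|x] := EVT_max_rV _ (compact_closedI cbox csub) cf.
  exists a; split=> i /=; last exact/ltW/Ka.
  by rewrite in_itv/= lexx ab.
rewrite inE => -[xbox xsub] xmax.
have {}xbox i : a 0 i <= x 0 i <= b 0 i by have := xbox i; rewrite /= in_itv.
exists x => //; apply/rowP => i; apply/eqP; rewrite eq_le xsub leNgt/=.
apply/negP => Kx.
(* If [x] met [b] at [i], then [K_mono] between [x] and [b] would give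
   [K x 0 i >= K b 0 i > k 0 i]. *)
have xb : x 0 i < b 0 i.
  rewrite lt_neqAle; have /andP[_ ->] := xbox i; rewrite andbT.
  apply: contraTneq Kx => xb; rewrite -leNgt.
  rewrite (le_trans (ltW (Kb i)))// K_mono// => j.
  by have /andP[] := xbox j.
pose xt (t : R) : 'rV[R]_n := x + t *: delta_mx 0 i.
have xtE t j : xt t 0 j = x 0 j + t * (j == i)%:R.
  by rewrite !mxE eqxx.
have xt0 : xt 0 = x by apply/rowP => j; rewrite xtE mul0r addr0.
have cxt : {for 0, continuous xt}.
  apply: differentiable_continuous; apply/derivable1_diffP.
  apply: derivableD; first exact: derivable_cst.
  by apply: diff_derivable; exact: differentiableZl.
have : \forall t \near (0 : R), K (xt t) 0 i < k 0 i.
  have cK : K (xt t) 0 i @[t --> (0 : R)] --> K (xt 0) 0 i.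
    suff : {for 0, continuous (fun t => K (xt t) 0 i)} by [].
    exact: (@continuous_comp _ _ _ xt (fun y => K y 0 i) 0 cxt (@K_cont i _)).
  by have /cvgr_lt := cK; apply; rewrite xt0.
move=> /nbhs_ballP[e /= e0 he].
pose t := Num.min (e / 2) (b 0 i - x 0 i).
have t0 : 0 < t by rewrite lt_min divr_gt0//= subr_gt0.
have te : t < e.
  by rewrite /t gt_min ltr_pdivrMr// ltr_pMr// ltr1n.
have Kt : K (xt t) 0 i < k 0 i.
  by apply: he; rewrite /ball/= sub0r normrN gtr0_norm.
have xxt j : x 0 j <= xt t 0 j.
  by rewrite xtE lerDl mulr_ge0// ltW.
have /xmax : xt t \in box `&` sub.
  rewrite inE; split=> j /=; have [->|ji] := eqVneq j i.
  - rewrite in_itv/= xtE eqxx mulr1; have /andP[aj _] := xbox i.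
    rewrite (le_trans aj) ?lerDl ?(ltW t0)//=.
    by rewrite -lerBrDl /t ge_min lexx orbT.
  - by rewrite in_itv/= xtE (negbTE ji) mulr0 addr0.
  - exact: ltW.
  - rewrite (le_trans _ (xsub j))// K_mono// xtE (negbTE ji).
    by rewrite mulr0 addr0.
apply/negP; rewrite -ltNge /f (bigD1 i)//= [ltRHS](bigD1 i)//=.
apply: ltr_leD; first by rewrite xtE eqxx mulr1 ltrDl.
exact: ler_sum.
Qed.

End Perron.

(** * Angles of triangles with given radii *)

Section HyperbolicFunctions.
Variable R : realType.
Implicit Types x y : R.

Lemma cosh2 x : cosh x ^+ 2 = 1 + sinh x ^+ 2.
Proof.
have := expRxMexpNx_1 x; rewrite /cosh /sinh.
by move: (expR x) (expR (- x)) => u v uv; have := uv; nra.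
Qed.

Lemma cosh_gt0 x : 0 < cosh x.
Proof. by rewrite divr_gt0// addr_gt0// expR_gt0. Qed.

Lemma sinh_gt0 x : 0 < x -> 0 < sinh x.
Proof. by move=> x0; rewrite divr_gt0// subr_gt0 ltr_expR; lra. Qed.

Lemma coshD x y : cosh (x + y) = cosh x * cosh y + sinh x * sinh y.
Proof. by rewrite /cosh /sinh opprD !expRD; field. Qed.

Lemma sinhD x y : sinh (x + y) = sinh x * cosh y + cosh x * sinh y.
Proof. by rewrite /cosh /sinh opprD !expRD; field. Qed.

Lemma sinh_surj y : 0 < y -> exists2 x, 0 < x & sinh x = y.
Proof.
move=> y0; pose w := Num.sqrt (1 + y ^+ 2).
have w2 : w ^+ 2 = 1 + y ^+ 2 by rewrite sqr_sqrtr// addr_ge0// sqr_ge0.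
have w0 : 0 < w by rewrite sqrtr_gt0 ltr_wpDr// sqr_ge0.
have w1 : 1 <= w by rewrite -[1]sqrtr1 ler_wsqrtr// lerDl sqr_ge0.
have yw : 1 < y + w by lra.
exists (ln (y + w)); first exact: ln_gt0.
rewrite /sinh expRN lnK ?posrE; last lra.
rewrite (_ : (y + w)^-1 = w - y); first lra.
have yw0 : y + w != 0 by rewrite gt_eqF// (lt_trans ltr01).
by apply: (mulfI yw0); rewrite mulfV// addrC [_ * _]mulrC -subr_sqr w2; ring.
Qed.

End HyperbolicFunctions.

(** * The quantity cot^2 (theta / 2) in both geometries *)

Section CornerRatio.
Variable R : realType.
Implicit Types s p q r t : R.

(* coth t if s = 1 and p = 1 / sinh t, and p if s = 0. *)
Definition hyp_coth s p := Num.sqrt (p ^+ 2 + s ^+ 2).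

(* cot^2 (theta / 2) for the angle theta at the vertex with coordinate p. *)
Definition corner_ratio s p q r :=
  (hyp_coth s p * hyp_coth s q + hyp_coth s q * hyp_coth s r
    + hyp_coth s r * hyp_coth s p + s ^+ 2) / p ^+ 2.

Lemma hyp_coth0 p : 0 < p -> hyp_coth 0 p = p.
Proof. by move=> p0; rewrite /hyp_coth expr0n addr0 sqrtr_sqr gtr0_norm. Qed.

Lemma hyp_coth1 t : 0 < t -> hyp_coth 1 (sinh t)^-1 = cosh t / sinh t.
Proof.
move=> t0; have s0 := sinh_gt0 t0.
rewrite /hyp_coth (_ : _ + _ = (cosh t / sinh t) ^+ 2).
  by rewrite sqrtr_sqr gtr0_norm// divr_gt0// cosh_gt0.
by rewrite expr_div_n cosh2; field; rewrite gt_eqF.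
Qed.

Lemma hyp_coth_gt0 s p : 0 < p -> 0 < hyp_coth s p.
Proof. by move=> p0; rewrite sqrtr_gt0 ltr_wpDr ?sqr_ge0// exprn_gt0. Qed.

Lemma corner_ratio_gt0 s p q r : 0 < p -> 0 < q -> 0 < r ->
  0 < corner_ratio s p q r.
Proof.
move=> p0 q0 r0; rewrite divr_gt0 ?exprn_gt0//.
by rewrite ltr_wpDr ?sqr_ge0// !addr_gt0// mulr_gt0// hyp_coth_gt0.
Qed.

Lemma eucl_corner p q r : 0 < p -> 0 < q -> 0 < r ->
  let N := corner_ratio 0 p^-1 q^-1 r^-1 in
  eucl_angle (r + p) (p + q) (q + r) = acos ((N - 1) / (N + 1)).
Proof.
move=> p0 q0 r0 /=; rewrite /corner_ratio !hyp_coth0 ?invr_gt0//.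
rewrite /eucl_angle; congr acos; field.
by apply/and5P; split; rewrite ?gt_eqF//= ?addr_gt0 ?mulr_gt0 ?addr_gt0.
Qed.

(** After multiplying N - 1 and N + 1 by [sinh q * sinh r], numerators and denominators agree
    separately, by the addition formulas and [cosh2 p]. *)
Lemma hyp_corner p q r : 0 < p -> 0 < q -> 0 < r ->
  let N := corner_ratio 1 (sinh p)^-1 (sinh q)^-1 (sinh r)^-1 in
  hyp_angle (r + p) (p + q) (q + r) = acos ((N - 1) / (N + 1)).
Proof.
move=> p0 q0 r0 N.
have [sp sq sr] := And3 (sinh_gt0 p0) (sinh_gt0 q0) (sinh_gt0 r0).
have cp := cosh2 p.
have NE : N * (sinh q * sinh r) = sinh p * (cosh p * cosh q * sinh r
    + cosh q * cosh r * sinh p + cosh r * cosh p * sinh q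
    + sinh p * sinh q * sinh r).
  rewrite /N /corner_ratio !hyp_coth1//; field.
  by rewrite !gt_eqF.
have qr0 : sinh q * sinh r != 0 by rewrite gt_eqF// mulr_gt0.
have -> : (N - 1) / (N + 1) =
    (N - 1) * (sinh q * sinh r) / ((N + 1) * (sinh q * sinh r)).
  by rewrite -mulf_div divff// mulr1.
rewrite /hyp_angle [(N - 1) * _]mulrBl [(N + 1) * _]mulrDl mul1r NE.
rewrite !coshD !sinhD; congr (acos (_ / _)).
  ring: cp.
ring: cp.
Qed.

(** [hyp_coth] is homogeneous of degree 1 in its two arguments under positive scaling, hence
    [corner_ratio] is of degree 0 in all four. *)
Lemma corner_ratio_scale s a p q r : 0 < a ->
  corner_ratio s (a * p) (a * q) (a * r) = corner_ratio (s / a) p q r.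
Proof.
move=> a0.
have dE t : hyp_coth s (a * t) = a * hyp_coth (s / a) t.
  rewrite /hyp_coth (_ : _ + _ = a ^+ 2 * (t ^+ 2 + (s / a) ^+ 2)).
    by rewrite sqrtrM ?sqr_ge0// sqrtr_sqr gtr0_norm.
  by field; rewrite gt_eqF.
(* No sign of [p] is assumed; at [p = 0] both sides are 0 because [0^-1 = 0]. *)
have [->|p0] := eqVneq p 0.
  by rewrite /corner_ratio mulr0 expr0n invr0 !mulr0.
by rewrite /corner_ratio !dE; field; rewrite p0 gt_eqF.
Qed.

Lemma hyp_coth_le s p q : 0 <= p -> p <= q -> hyp_coth s p <= hyp_coth s q.
Proof.
by move=> p0 pq; rewrite ler_wsqrtr// lerD2r lerXn2r// nnegrE (le_trans p0).
Qed.

Lemma hyp_coth_ge s p : 0 <= p -> p <= hyp_coth s p.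
Proof.
move=> p0; rewrite -{1}[p](ger0_norm p0) -sqrtr_sqr ler_wsqrtr// lerDl.
exact: sqr_ge0.
Qed.

Lemma corner_ratio_le s p q r q' r' : 0 < p -> 0 < q -> 0 < r ->
  q <= q' -> r <= r' -> corner_ratio s p q r <= corner_ratio s p q' r'.
Proof.
move=> p0 q0 r0 qq rr; rewrite /corner_ratio ler_wpM2r ?invr_ge0 ?sqr_ge0//.
have := hyp_coth_le s (ltW q0) qq; have := hyp_coth_le s (ltW r0) rr.
have := hyp_coth_gt0 s p0; have := hyp_coth_gt0 s q0; have := hyp_coth_gt0 s r0.
move: (hyp_coth s p) (hyp_coth s q) (hyp_coth s r).
move: (hyp_coth s q') (hyp_coth s r') => b' c' a b c c0 b0 a0 cc bb.
have := ler_pM (ltW b0) (ltW c0) bb cc; nra.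
Qed.

(** The products of [hyp_coth] increase weakly with [s]; strictness comes from the summand
    [s ^+ 2]. *)
Lemma corner_ratio_lt_scale s t p q r : 0 < p -> 0 < q -> 0 < r ->
  0 <= s -> s < t -> corner_ratio s p q r < corner_ratio t p q r.
Proof.
move=> p0 q0 r0 s0 st.
have st2 : s ^+ 2 < t ^+ 2 by rewrite ltrXn2r// nnegrE ltW// (le_lt_trans s0).
have dle u : hyp_coth s u <= hyp_coth t u.
  by rewrite ler_wsqrtr// lerD2l ltW.
rewrite ltr_pM2r ?invr_gt0 ?exprn_gt0//.
have d0 u : 0 <= hyp_coth s u by rewrite sqrtr_ge0.
by rewrite ler_ltD// !lerD// ler_pM.
Qed.

(** Keep a single summand of the numerator and use [hyp_coth s p >= p]. A bound on N thus bounds q /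
    p, r / p and s / p, the compactness input of [closed_curv]. *)
Lemma corner_ratio_ge s p q r : 0 < p -> 0 < q -> 0 < r ->
  [/\ q <= corner_ratio s p q r * p, r <= corner_ratio s p q r * p
    & s ^+ 2 <= corner_ratio s p q r * p ^+ 2].
Proof.
move=> p0 q0 r0.
have p2 : 0 < p ^+ 2 by rewrite exprn_gt0.
have E : corner_ratio s p q r * p ^+ 2 = hyp_coth s p * hyp_coth s q
    + hyp_coth s q * hyp_coth s r + hyp_coth s r * hyp_coth s p + s ^+ 2.
  by rewrite divfK// gt_eqF.
have := hyp_coth_gt0 s p0; have := hyp_coth_gt0 s q0; have := hyp_coth_gt0 s r0.
move=> dr dq dp.
have := hyp_coth_ge s (ltW p0); have := hyp_coth_ge s (ltW q0).
have := hyp_coth_ge s (ltW r0) => hr hq hp.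
have hpq := ler_pM (ltW p0) (ltW q0) hp hq.
have hpr := ler_pM (ltW p0) (ltW r0) hp hr.
have [dpq dqr drp] := And3 (mulr_gt0 dp dq) (mulr_gt0 dq dr) (mulr_gt0 dr dp).
have s2 := sqr_ge0 s.
split.
- by rewrite -(ler_pM2l p0) mulrCA -expr2 E; lra.
- by rewrite -(ler_pM2l p0) mulrCA -expr2 E; lra.
- by rewrite E; lra.
Qed.

End CornerRatio.

Section ContinuousRatio.
Variables (R : realType) (T : Type) (F : set_system T).
Context {FF : Filter F}.

Lemma cvg_hyp_coth (s p : T -> R) (s0 p0 : R) :
    s t @[t --> F] --> s0 -> p t @[t --> F] --> p0 ->
  hyp_coth (s t) (p t) @[t --> F] --> hyp_coth s0 p0.
Proof.
move=> cs cp; apply: (@cvg_comp _ _ _ _ (@Num.sqrt R)); last exact: sqrt_continuous.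
by apply: cvgD; exact: cvgM.
Qed.

Lemma cvg_corner_ratio (s p q r : T -> R) (s0 p0 q0 r0 : R) : 0 < p0 ->
    s t @[t --> F] --> s0 -> p t @[t --> F] --> p0 ->
    q t @[t --> F] --> q0 -> r t @[t --> F] --> r0 ->
  corner_ratio (s t) (p t) (q t) (r t) @[t --> F] --> corner_ratio s0 p0 q0 r0.
Proof.
move=> p00 cs cp cq cr; have dp := cvg_hyp_coth cs cp.
have dq := cvg_hyp_coth cs cq; have dr := cvg_hyp_coth cs cr.
apply: cvgM.
  by apply: cvgD; [apply: cvgD; [apply: cvgD|]|]; exact: cvgM.
by apply: cvgV; [rewrite gt_eqF// exprn_gt0|exact: cvgM].
Qed.

End ContinuousRatio.

Lemma near_row_itv (R : realType) (n : nat) (a b k : 'rV[R]_n) :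
  (forall i, a 0 i < k 0 i < b 0 i) ->
  \forall q \near k, forall i, a 0 i < (q : 'rV[R]_n) 0 i < b 0 i.
Proof.
move=> akb; apply: (@filter_forall _ _
  (fun i (q : 'rV[R]_n) => a 0 i < q 0 i < b 0 i) _ (nbhs_filter k)) => i.
have ck : q 0 i @[q --> k] --> k 0 i by exact: coord_continuous.
have /andP[ak kb] := akb i.
near=> q; apply/andP; split; near: q.
  by have /cvgr_gt := ck; apply.
by have /cvgr_lt := ck; apply.
Unshelve. all: by end_near. Qed.

(** * The curvature maps of a surface *)

Section Surface.
Variables (R : realType) (lambda : R) (S : closed_tri_surface).
Local Notation corner := (face S * 'I_3)%type.
Local Notation radii := 'rV[R]_(nvert S).
Implicit Types (c : corner) (v w : 'I_(nvert S)).

Definition corner_next c : corner := (c.1, c.2 + 1).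
Definition corner_prev c : corner := (c.1, c.2 + 2).

(** Connectedness of the surface: [P] spreads over a triangle by hypothesis, to an adjacent triangle
    through an end point of the common side, and then along chains of faces. *)
Lemma vert_ind (P : 'I_(nvert S) -> Prop) :
    (forall c, P (vert c) ->
       P (vert (corner_next c)) /\ P (vert (corner_prev c))) ->
  forall v w, P v -> P w.
Proof.
move=> Pnp.
have Pface f i j : P (vert (f, i)) -> P (vert (f, j)).
  move=> Pi; have [Pn Pp] := Pnp _ Pi.
  move: Pi Pn Pp; rewrite /corner_next /corner_prev/=.
  have : [\/ j = i, j = i + 1 | j = i + 2].
    case: i j => [[|[|[|//]]] i3] [[|[|[|//]]] j3];
    by [constructor 1; apply: val_inj|constructor 2; apply: val_inj|
        constructor 3; apply: val_inj].
  by case=> ->.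
have Padj f g : face_adjacent (@Defs.glue S) f g ->
    (forall i, P (vert (f, i))) -> forall i, P (vert (g, i)).
  move=> /existsP[i /existsP[j /eqP gE]] Pf k.
  have : vert (endpoint (f, i) true) =
      vert (endpoint (g, j) (true (+) twist (f, i))).
    apply/eqP; rewrite vert_eq; apply/connect1/existsP; exists (f, i).
    by apply/existsP; exists true; rewrite gE !eqxx.
  by rewrite /endpoint/= => vE; have := Pf (i + 1); rewrite vE; exact: Pface.
have Pconn f g : connect (face_adjacent (@Defs.glue S)) f g ->
    (forall i, P (vert (f, i))) -> forall i, P (vert (g, i)).
  move=> /connectP[s]; elim: s f => [|h s IH] f /=; first by move=> _ ->.
  by move=> /andP[fh hs] gE Pf; apply: (IH h hs gE); exact: Padj Pf.
move=> v w; have [[f i] <-] := vert_surj v; have [[g j] <-] := vert_surj w.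
by move=> Pv; apply: (Pconn f g (face_connected f g)) => k; exact: Pface Pv.
Qed.

Definition tri_ratio (s : R) (p : radii) c : R :=
  corner_ratio s (p 0 (vert c)) (p 0 (vert (corner_next c)))
    (p 0 (vert (corner_prev c))).

(* The Euclidean (s = 0) or hyperbolic (s = 1) curvature. *)
Definition curv (s : R) (p : radii) : radii :=
  \row_v \sum_(c | vert c == v) corner_term lambda (tri_ratio s p c).

Lemma endpoint_sides c :
  [/\ endpoint (corner_next c) true = corner_prev c,
      endpoint (corner_next c) false = c,
      endpoint (corner_prev c) true = c,
      endpoint (corner_prev c) false = corner_next c &
      endpoint c true = corner_next c /\ endpoint c false = corner_prev c].
Proof.
case: c => f [[|[|[|//]]] i3]; rewrite /endpoint /corner_next /corner_prev/=;
  by split; try split; congr pair; apply: val_inj.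
Qed.

Lemma K_euclE (r : radii) : CP R S r ->
  K_eucl lambda S r = curv 0 (map_mx GRing.inv r).
Proof.
move=> r0; apply/rowP => v; rewrite !mxE; apply: eq_bigr => c _.
rewrite /corner_angle /edge_length.
have [-> -> -> -> [-> ->]] := endpoint_sides c.
by rewrite eucl_corner// /corner_term /tri_ratio !mxE.
Qed.

Lemma K_hypE (r : radii) : CP R S r ->
  K_hyp lambda S r = curv 1 (map_mx (fun t => (sinh t)^-1) r).
Proof.
move=> r0; apply/rowP => v; rewrite !mxE; apply: eq_bigr => c _.
rewrite /corner_angle /edge_length.
have [-> -> -> -> [-> ->]] := endpoint_sides c.
by rewrite hyp_corner// /corner_term /tri_ratio !mxE.
Qed.

Lemma image_K_eucl : K_eucl lambda S @` CP R S = curv 0 @` CP R S.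
Proof.
apply/seteqP; split=> _ [r r0 <-].
  exists (map_mx GRing.inv r); last by rewrite K_euclE.
  by move=> v; rewrite mxE invr_gt0.
exists (map_mx GRing.inv r).
  by move=> v; rewrite mxE invr_gt0.
rewrite K_euclE; last by move=> v; rewrite mxE invr_gt0.
by congr curv; apply/rowP => v; rewrite !mxE invrK.
Qed.

Lemma image_K_hyp : K_hyp lambda S @` CP R S = curv 1 @` CP R S.
Proof.
apply/seteqP; split=> _ [r r0 <-].
  exists (map_mx (fun t => (sinh t)^-1) r); last by rewrite K_hypE.
  by move=> v; rewrite mxE invr_gt0 sinh_gt0.
have r'0 v : 0 < (r 0 v)^-1 by rewrite invr_gt0.
pose t := \row_v s2val (cid2 (sinh_surj (r'0 v))).
have t0 : CP R S t by move=> v; rewrite mxE; case: cid2.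
exists t => //; rewrite K_hypE//; congr curv.
apply/rowP => v; rewrite !mxE; case: cid2 => x /= _ ->.
by rewrite invrK.
Qed.

Lemma tri_ratio_gt0 s p c : CP R S p -> 0 < tri_ratio s p c.
Proof. by move=> p0; exact: corner_ratio_gt0. Qed.

Lemma curv_scale s a p : 0 < a -> curv s (a *: p) = curv (s / a) p.
Proof.
move=> a0; apply/rowP => v; rewrite !mxE; apply: eq_bigr => c _.
by rewrite /tri_ratio !mxE corner_ratio_scale.
Qed.

Lemma curv_lt s t p v : CP R S p -> 0 <= s -> s < t ->
  curv t p 0 v < curv s p 0 v.
Proof.
(* Strictness requires a nonempty sum: every vertex carries a corner. *)
move=> p0 s0 st; rewrite !mxE; have [c0 <-] := vert_surj v.
rewrite (bigD1 c0)//= [ltRHS](bigD1 c0)//=.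
have lt c : corner_term lambda (tri_ratio t p c) < corner_term lambda (tri_ratio s p c).
  by apply: corner_term_lt; [exact: tri_ratio_gt0|exact: corner_ratio_lt_scale].
by apply: ltr_leD => //; apply: ler_sum => c _; exact: ltW.
Qed.

(** The monotonicity required by [perron]: raising the other coordinates raises N at every corner of
    [v]. *)
Lemma curv_le (s : R) (p q : radii) v : CP R S p ->
    (forall w, p 0 w <= q 0 w) ->
  p 0 v = q 0 v -> curv s q 0 v <= curv s p 0 v.
Proof.
move=> p0 pq pqv; rewrite !mxE; apply: ler_sum => c /eqP cv.
apply: corner_term_le; first exact: tri_ratio_gt0.
by rewrite /tri_ratio cv -pqv; exact: corner_ratio_le.
Qed.

Lemma cvg_curv (T : Type) (F : set_system T) (FF : Filter F) (s : T -> R)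
    (p : T -> radii) (s0 : R) (p0 : radii) : CP R S p0 ->
    s t @[t --> F] --> s0 -> p t @[t --> F] --> p0 ->
  curv (s t) (p t) @[t --> F] --> curv s0 p0.
Proof.
move=> p00 cs cp; apply: cvg_row => v; rewrite mxE.
under eq_cvg do rewrite mxE.
have cpv w : p t 0 w @[t --> F] --> p0 0 w.
  by apply: (cvg_comp _ (fun q : radii => q 0 w) cp); exact: coord_continuous.
apply: cvg_big => [|c _]; first exact: add_continuous.
apply: (cvg_comp _ (corner_term lambda)).
  exact: (cvg_corner_ratio (p00 _) cs (cpv _) (cpv _) (cpv _)).
by apply: continuous_corner_term; exact: tri_ratio_gt0.
Qed.

(** * Closedness, openness and boundary of the images *)

Hypothesis lambda_leN1 : lambda <= -1.

(** Used for [J = {0}] and for [J = [0, +oo[]. Stability of [J] under division permits rescaling to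
    [p 0 v0 = 1]. Parameters whose curvature is close to [k] are then confined to a compact set [Q],
    and the image of [Q] is closed. *)
Lemma closed_curv (J : set R) : closed J -> (forall s, J s -> 0 <= s) ->
    (forall s a, 0 < a -> J s -> J (s / a)) ->
  closed [set curv sp.1 sp.2 | sp in J `*` CP R S].
Proof.
move=> cJ J0 JV k kcl.
have /card_gt0P[f0 _] := @face_nonempty S.
pose v0 := vert (f0, 0).
(* The other terms at a vertex sum to at most the number of corners, so a curvature above [k - 1]
   forces each term above [- C], and N below [E] by [corner_term_ge]. *)
pose C := \sum_v `|k 0 v - 1| + #|{: corner}|%:R.
have C0 : 0 <= C by rewrite addr_ge0// sumr_ge0.
pose E := expR (2 * C).
have E0 : 0 < E := expR_gt0 _.
pose bounded sp :=
  [/\ 0 <= sp.1, CP R S sp.2 & forall c, tri_ratio sp.1 sp.2 c <= E].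
have bounded_curv s p : J s -> CP R S p ->
    (forall v, k 0 v - 1 < curv s p 0 v) ->
    bounded (s, p).
  move=> Js p0 kc; split=> [||c] //=; first exact: J0.
  apply: (corner_term_ge lambda_leN1) => //; first exact: tri_ratio_gt0.
  have := kc (vert c); rewrite mxE (bigD1 c)//= => kc'.
  have le1 : \sum_(d | (vert d == vert c) && (d != c))
      corner_term lambda (tri_ratio s p d) <= #|{: corner}|%:R.
    apply: (@le_trans _ _ (\sum_(d : corner) 1)); last by rewrite sumr_const.
    rewrite [leRHS](bigID (fun d => (vert d == vert c) && (d != c)))/=.
    rewrite ler_wpDr ?sumr_ge0// ler_sum// => d _.
    by apply: corner_term_le1 => //; exact: tri_ratio_gt0.
  have le2 : - (k 0 (vert c) - 1) <= \sum_v `|k 0 v - 1|.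
    rewrite (bigD1 (vert c))//= ler_wpDr ?sumr_ge0//.
    by rewrite -normrN ler_norm.
  have := lt_le_trans kc' (lerD (lexx _) le1); move: le2; rewrite /C.
  move: (\sum_v _) (_%:R) (corner_term _ _) (k 0 _) => X Y T z; lra.
(* Passing to another vertex of the same triangle costs a factor [E]; by [vert_ind] each vertex gets
   a constant that is uniform in [sp]. *)
have comparable_radii v : exists d : R, 0 < d /\ forall sp, bounded sp ->
    d * sp.2 0 v0 <= sp.2 0 v /\ d * sp.2 0 v <= sp.2 0 v0.
  apply: (@vert_ind (fun v => exists d : R, 0 < d /\ forall sp, bounded sp ->
    d * sp.2 0 v0 <= sp.2 0 v /\ d * sp.2 0 v <= sp.2 0 v0) _ v0); last first.
    by exists 1; split=> // sp _; rewrite mul1r.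
  move=> c [d [d0 dP]].
  have step v' : (forall sp, bounded sp -> sp.2 0 v' <= E * sp.2 0 (vert c) /\
        sp.2 0 (vert c) <= E * sp.2 0 v') ->
      exists d : R, 0 < d /\ forall sp, bounded sp ->
        d * sp.2 0 v0 <= sp.2 0 v' /\ d * sp.2 0 v' <= sp.2 0 v0.
    move=> vE; exists (d / E); split=> [|sp bsp]; first exact: divr_gt0.
    have [h1 h2] := vE sp bsp; have [h3 h4] := dP sp bsp.
    split; rewrite mulrAC ler_pdivrMr//.
      by rewrite (le_trans h3)// mulrC.
    by rewrite (le_trans _ (ler_wpM2r (ltW E0) h4))// -mulrA ler_pM2l// mulrC.
  have ge_ratio s p x : CP R S p -> tri_ratio s p x <= E ->
      p 0 (vert (corner_next x)) <= E * p 0 (vert x) /\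
      p 0 (vert (corner_prev x)) <= E * p 0 (vert x).
    move=> p0 xE; have [qN rN _] := corner_ratio_ge s (p0 (vert x))
      (p0 (vert (corner_next x))) (p0 (vert (corner_prev x))).
    by split; [apply: le_trans qN _|apply: le_trans rN _]; rewrite ler_pM2r.
  have [np pn] : corner_prev (corner_next c) = c /\ corner_next (corner_prev c) = c.
    by have [_ pn np _ _] := endpoint_sides c.
  split; apply: step => -[s p] [/= s0 p0 pE].
    by have [? _] := ge_ratio s p c p0 (pE c);
       have [_] := ge_ratio s p (corner_next c) p0 (pE _); rewrite np.
  by have [_ ?] := ge_ratio s p c p0 (pE c);
     have [+ _] := ge_ratio s p (corner_prev c) p0 (pE _); rewrite pn.
have [d dP] := choice comparable_radii.
(* After rescaling, [s ^+ 2 <= E] follows from the third bound of [corner_ratio_ge], and the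
   intervals for [p] from the comparison with [p 0 v0 = 1]. *)
pose Q := (J `&` `[0, Num.sqrt E]) `*`
  [set p : radii | forall v, `[d v, (d v)^-1]%classic (p 0 v)].
have cQ : compact Q.
  apply: compact_setX.
    by rewrite setIC; apply: compact_closedI => //; exact: segment_compact.
  apply: (@rV_compact _ _ (fun v => `[d v, (d v)^-1]%classic)) => v.
  exact: segment_compact.
have Qpos sp : Q sp -> CP R S sp.2.
  move=> [_ h] v; have := h v; rewrite /= in_itv/= => /andP[+ _].
  by apply: lt_le_trans; have [] := dP v.
have closed_image : closed [set curv sp.1 sp.2 | sp in Q].
  apply: compact_closed; first exact: norm_hausdorff.
  apply: continuous_compact cQ.
  apply: continuous_in_subspaceT => sp; rewrite inE => Qsp.
  apply: (cvg_curv (nbhs_filter sp)) => //; first exact: Qpos.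
    exact: cvg_fst.
  exact: cvg_snd.
suff : [set curv sp.1 sp.2 | sp in Q] k.
  move=> [sp Qsp <-]; exists sp => //; split; last exact: Qpos.
  by case: Qsp => -[].
apply: closed_image => B Bk.
have nk : \forall q \near k, forall v, k 0 v - 1 < (q : radii) 0 v.
  have k1 v : k 0 v - 1 < k 0 v < k 0 v + 1 by rewrite ltrDl gtrBl ltr01.
  apply: filterS (near_row_itv (a := \row_v (k 0 v - 1))
    (b := \row_v (k 0 v + 1)) _).
    by move=> q /= kq v; have := kq v; rewrite !mxE => /andP[].
  by move=> v; rewrite !mxE.
have [_ [[[s p] [/= Js p0] <-] [Bq kq]]] := kcl _ (filterI Bk nk).
exists (curv s p); split=> //.
have bsp := bounded_curv _ _ Js p0 kq.
have p00 : 0 < (p 0 v0)^-1 by rewrite invr_gt0.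
exists (s / p 0 v0, (p 0 v0)^-1 *: p); last first.
  by rewrite /= curv_scale// invrK mulfVK// gt_eqF.
split=> /=.
  split; first exact: JV.
  have s0 : 0 <= s / p 0 v0 by rewrite divr_ge0 ?(J0 s)// ltW.
  rewrite in_itv/= s0/= -(ler_sqr (x := s / _)) ?nnegrE ?sqrtr_ge0//.
  rewrite sqr_sqrtr ?(ltW E0)//.
  rewrite expr_div_n ler_pdivrMr ?exprn_gt0//.
  have [_ _ rE] := bsp; have c0E := rE (f0, 0).
  have [_ _ sN] := corner_ratio_ge s (p0 v0) (p0 (vert (corner_next (f0, 0))))
    (p0 (vert (corner_prev (f0, 0)))).
  by rewrite (le_trans sN)// ler_pM2r ?exprn_gt0.
move=> v; have [dv /(_ _ bsp)/= [h1 h2]] := dP v.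
rewrite in_itv/= mxE mulrC ler_pdivlMr// h1/= ler_pdivrMr//.
by rewrite mulrC ler_pdivlMr// mulrC.
Qed.

Lemma open_image_hyp : open (curv 1 @` CP R S).
Proof.
rewrite openE => _ [p p0 <-].
(* In logarithmic coordinates the map is continuous on the whole space, as [perron] demands. *)
pose F (x : radii) := curv 1 (map_mx expR x).
have F_cont i : continuous (fun x : radii => F x 0 i).
  move=> x; suff Fx : F y @[y --> x] --> F x.
    by apply: (cvg_comp _ (fun q : radii => q 0 i) Fx); exact: coord_continuous.
  apply: (cvg_curv (nbhs_filter x)).
  - by move=> v; rewrite mxE expR_gt0.
  - exact: cvg_cst.
  - apply: (cvg_row (nbhs_filter x)) => v; rewrite mxE.
    under eq_cvg do rewrite mxE.
    apply: (cvg_comp _ (@expR R) (@coord_continuous _ _ _ 0 v x)).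
    exact: continuous_expR.
have F_mono (x y : radii) i : (forall j, x 0 j <= y 0 j) -> x 0 i = y 0 i ->
    F y 0 i <= F x 0 i.
  move=> xy xyi; apply: curv_le => [v|v|]; rewrite !mxE ?expR_gt0 ?ler_expR//.
  by rewrite xyi.
(* The corners p / 2 and 2 p of the box thus have curvatures [curv 2 p] and [curv 2^-1 p], strictly
   on either side of [curv 1 p] by [curv_lt]. *)
have scaleE (t : R) : 0 < t -> F (\row_v ln (t * p 0 v)) = curv t^-1 p.
  move=> t0; rewrite -[t^-1]mul1r -curv_scale//; congr curv.
  by apply/rowP => v; rewrite !mxE lnK// posrE mulr_gt0.
have /filterS : forall q : radii,
    (forall i, curv 2 p 0 i < q 0 i < curv 2^-1 p 0 i) -> (curv 1 @` CP R S) q.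
  move=> q hq.
  have [i|i|i|x _ <-] := @perron _ _ F F_cont F_mono (\row_v ln (2^-1 * p 0 v))
      (\row_v ln (2 * p 0 v)) q; last first.
  - by exists (map_mx expR x) => // v; rewrite mxE expR_gt0.
  - by rewrite scaleE//; have /andP[] := hq i.
  - by rewrite scaleE ?invr_gt0// invrK; have /andP[] := hq i.
  - rewrite !mxE ler_ln ?posrE ?mulr_gt0 ?invr_gt0//.
    by rewrite ler_wpM2r//; [exact/ltW/p0|lra].
apply; apply: near_row_itv => i; apply/andP; split; apply: curv_lt => //; lra.
Qed.

(** A limit point is [curv s p] for some s >= 0. If s > 0, rescaling to s = 1 puts it in the open
    hyperbolic image, so it is no boundary point; s = 0 remains. *)
Lemma boundary_image_hyp :
  topological_boundary (curv 1 @` CP R S) `<=` curv 0 @` CP R S.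
Proof.
move=> k [kcl]; have /interior_id -> := open_image_hyp => kni.
have cl : closed [set curv sp.1 sp.2 | sp in `[0, +oo[ `*` CP R S].
  apply: closed_curv => [|s|s a a0].
  - exact: interval_closed.
  - by rewrite /= in_itv/= andbT.
  - by rewrite /= !in_itv/= !andbT => s0; rewrite divr_ge0// ltW.
have [|[s p] [/= + p0] kE] := cl k.
  apply: closureS kcl => _ [p p0 <-]; exists (1, p) => //; split => //=.
  by rewrite in_itv/= ler01.
rewrite in_itv/= andbT le_eqVlt => /predU1P[s0|s0].
  by exists p => //; rewrite s0.
case: kni; exists (s^-1 *: p); last by rewrite curv_scale ?invr_gt0// invrK mul1r.
by move=> v; rewrite mxE mulr_gt0 ?invr_gt0.
Qed.

Lemma closed_image_eucl : closed (curv 0 @` CP R S).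
Proof.
have -> : curv 0 @` CP R S = [set curv sp.1 sp.2 | sp in [set 0] `*` CP R S].
  apply/seteqP; split=> [_ [p p0 <-]|_ [[s p] [/= -> p0] <-]]; last by exists p.
  by exists (0, p).
apply: closed_curv => [|s ->//|s a a0 ->]; last by rewrite /= mul0r.
exact: closed_eq.
Qed.

End Surface.

(** * A global chart *)

Section Chart.
Variables (R : realType) (lambda : R) (S : closed_tri_surface).
Variable v0 : 'I_(nvert S).
Local Notation corner := (face S * 'I_3)%type.
Local Notation radii := 'rV[R]_(nvert S).
Implicit Types (c : corner) (v w : 'I_(nvert S)) (x y u : radii).

(** With x = log p these are the quotients a = p_j / p_i and b = p_k / p_i; in the Euclidean case N
    = a + b + a b. *)
Definition next_ratio c x :=
  expR (x 0 (vert (corner_next c)) - x 0 (vert c)).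
Definition prev_ratio c x :=
  expR (x 0 (vert (corner_prev c)) - x 0 (vert c)).
Definition log_ratio c x :=
  next_ratio c x + prev_ratio c x + next_ratio c x * prev_ratio c x.

Lemma log_ratioE c x : tri_ratio 0 (map_mx expR x) c = log_ratio c x.
Proof.
rewrite /tri_ratio /corner_ratio !mxE !hyp_coth0 ?expR_gt0// expr0n addr0.
rewrite /log_ratio /next_ratio /prev_ratio !expRB; field.
by rewrite gt_eqF ?expR_gt0.
Qed.

Lemma log_ratio_gt0 c x : 0 < log_ratio c x.
Proof. by rewrite !addr_gt0// ?mulr_gt0 ?expR_gt0. Qed.

(** Euclidean curvature does not change when a constant is added to all coordinates of [x]; the
    summand at [v0] detects such a shift. *)
Definition chart x : radii :=
  curv lambda 0 (map_mx expR x) + x 0 v0 *: delta_mx 0 v0.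

Lemma chart_curv x v : chart x 0 v =
  curv lambda 0 (map_mx expR x) 0 v + x 0 v0 * (v == v0)%:R.
Proof. by rewrite /chart mxE; congr (_ + _); rewrite !mxE eqxx. Qed.

Lemma chartE x v : chart x 0 v =
  (\sum_(c | vert c == v) corner_term lambda (log_ratio c x))
    + x 0 v0 * (v == v0)%:R.
Proof.
rewrite chart_curv; congr (_ + _).
by rewrite mxE; apply: eq_bigr => c _; rewrite log_ratioE.
Qed.

Lemma smooth_next_ratio c : smooth (next_ratio c).
Proof.
apply: smooth_exp; apply: smoothD; first exact: smooth_coord.
by apply: smoothN; exact: smooth_coord.
Qed.

Lemma smooth_prev_ratio c : smooth (prev_ratio c).
Proof.
apply: smooth_exp; apply: smoothD; first exact: smooth_coord.
by apply: smoothN; exact: smooth_coord.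
Qed.

Lemma smooth_log_ratio c : smooth (log_ratio c).
Proof.
have s1 := smooth_next_ratio c; have s2 := smooth_prev_ratio c.
by apply: smoothD; [exact: smoothD|exact: smoothM].
Qed.

Lemma smooth_corner_term c : smooth (fun x => corner_term lambda (log_ratio c x)).
Proof.
apply: (smooth_comp (h := corner_term lambda) (h' := corner_term' lambda)).
- exact: smooth_log_ratio.
- by move=> x; apply: is_derive_corner_term; exact: log_ratio_gt0.
- have s := smooth_log_ratio c.
  apply: smoothN; apply: smoothM.
    by apply: smooth_powR => // x; exact: log_ratio_gt0.
  apply: smoothV; first by apply: smoothD => //; exact: smooth_cst.
  by move=> x; rewrite gt_eqF// addr_gt0// log_ratio_gt0.
Qed.

Lemma smooth_chart v : smooth (fun x => chart x 0 v).
Proof.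
rewrite (_ : (fun _ => _) = fun x =>
  (\sum_(c | vert c == v) corner_term lambda (log_ratio c x))
    + x 0 v0 * (v == v0)%:R); last by apply/funext => x; rewrite chartE.
apply: smoothD; first by apply: smooth_sum => c _; exact: smooth_corner_term.
by apply: smoothM; [exact: smooth_coord|exact: smooth_cst].
Qed.

Lemma is_derive_scalar_comp (h : R -> R) (f : radii -> R) x u dh df :
    differentiable f x -> is_derive x u f df -> is_derive (f x) 1 h dh ->
  is_derive x u (h \o f) (dh * df).
Proof.
move=> dfx [_ <-] dhf; have [d dE] := differentiable_comp1 dfx dhf.
by apply: DeriveDef; [exact: diff_derivable|exact: dE].
Qed.

Lemma is_derive_log_ratio c x u :
  is_derive x u (log_ratio c)
    (next_ratio c x * (1 + prev_ratio c x) *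
       (u 0 (vert (corner_next c)) - u 0 (vert c)) +
     prev_ratio c x * (1 + next_ratio c x) *
       (u 0 (vert (corner_prev c)) - u 0 (vert c))).
Proof.
have de a b : is_derive x u (fun y : radii => expR (y 0 a - y 0 b))
    (expR (x 0 a - x 0 b) * (u 0 a - u 0 b)).
  have dl := is_deriveB (is_derive_coord x u a) (is_derive_coord x u b).
  apply: (@is_derive_scalar_comp (@expR R) (fun y : radii => y 0 a - y 0 b)).
  by apply: differentiableB; exact: differentiable_coord.
have d1 := de (vert (corner_next c)) (vert c).
have d2 := de (vert (corner_prev c)) (vert c).
have d3 := is_deriveM d1 d2.
apply: (is_derive_eq (is_deriveD (is_deriveD d1 d2) d3)).
by rewrite /GRing.scale/= /next_ratio /prev_ratio; ring.
Qed.

Lemma derive_chart x u v : ('D_u chart x) 0 v =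
  \sum_(c | vert c == v) corner_term' lambda (log_ratio c x) *
    (next_ratio c x * (1 + prev_ratio c x) *
       (u 0 (vert (corner_next c)) - u 0 (vert c)) +
     prev_ratio c x * (1 + next_ratio c x) *
       (u 0 (vert (corner_prev c)) - u 0 (vert c)))
  + u 0 v0 * (v == v0)%:R.
Proof.
have dH : derivable chart x u.
  apply: diff_derivable; apply: differentiable_row => i.
  by have [] := smoothP (smooth_chart i).
rewrite derive_mx// mxE; apply: derive_val.
pose f c := fun y : radii => corner_term lambda (log_ratio c y).
rewrite (_ : (fun _ => _) = \sum_(c | vert c == v) f c
    + (fun y : radii => (v == v0)%:R *: y 0 v0)); last first.
  by apply/funext => y; rewrite chartE fctE fct_sumE mulrC.
rewrite [u 0 v0 * _]mulrC; apply: is_deriveD; last first.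
  by apply: is_deriveZ; exact: is_derive_coord.
elim/big_ind2 : _ => [|a a' b b' da db|c _]; first exact: is_derive_cst.
  exact: is_deriveD.
apply: (@is_derive_scalar_comp (corner_term lambda) (log_ratio c)).
- by have [] := smoothP (smooth_log_ratio c).
- exact: is_derive_log_ratio.
- by apply: is_derive_corner_term; exact: log_ratio_gt0.
Qed.

(* Maximum principle: by connectedness, the hypothesis propagates a negative
   minimum of u to the excluded vertex v0. *)
Lemma min_nonneg u :
    (forall v, (forall w, u 0 v <= u 0 w) -> u 0 v < 0 -> v != v0 /\
       forall c, vert c = v ->
         u 0 (vert (corner_next c)) = u 0 v /\ u 0 (vert (corner_prev c)) = u 0 v) ->
  forall v, 0 <= u 0 v.
Proof.
move=> hu; pose m := [arg min_(i < v0) u 0 i]%O.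
have mP w : u 0 m <= u 0 w by rewrite /m; case: arg_minP => // i _; exact.
suff m0 : 0 <= u 0 m by move=> v; exact: le_trans (mP v).
rewrite leNgt; apply/negP => m0.
pose P v := u 0 v = u 0 m.
have Pv0 : P v0.
  apply: (@vert_ind S P _ m v0); last by [].
  move=> c cm; have cmin w : u 0 (vert c) <= u 0 w by rewrite cm.
  have c0 : u 0 (vert c) < 0 by rewrite cm.
  by have [_ /(_ c erefl)[h1 h2]] := hu _ cmin c0; rewrite /P h1 h2.
have v0min w : u 0 v0 <= u 0 w by rewrite Pv0.
have v00 : u 0 v0 < 0 by rewrite Pv0.
by have [] := hu _ v0min v00; rewrite eqxx.
Qed.

(** At a negative minimum [v] of y - x, all quotients at [v] increase from [x] to [y], so the
    curvature decreases weakly. The hypothesis then forces equality, hence equal quotients; at [v0]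
    the extra summand gives a contradiction. *)
Lemma chart_le x y : (forall v, chart x 0 v <= chart y 0 v) ->
  forall v, x 0 v <= y 0 v.
Proof.
move=> hxy v; rewrite -subr_ge0.
suff : forall w, 0 <= (y - x) 0 w by move=> /(_ v); rewrite !mxE.
apply: min_nonneg => {}v vmin; rewrite !mxE => vneg.
have le1 c : vert c = v -> next_ratio c x <= next_ratio c y.
  move=> cv; rewrite ler_expR; have := vmin (vert (corner_next c)).
  by rewrite !mxE cv; lra.
have le2 c : vert c = v -> prev_ratio c x <= prev_ratio c y.
  move=> cv; rewrite ler_expR; have := vmin (vert (corner_prev c)).
  by rewrite !mxE cv; lra.
have le3 c : vert c = v -> log_ratio c x <= log_ratio c y.
  move=> cv; have [h1 h2] := (le1 c cv, le2 c cv).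
  by apply: lerD; [exact: lerD|exact: ler_pM (expR_ge0 _) (expR_ge0 _) h1 h2].
(* [a] and [b] are the corner terms of [x] and [y]; from here on only these three properties of them
   are used. *)
have [a [b [ba eq_ab hv]]] : exists a b : corner -> R,
   [/\ forall c, vert c = v -> b c <= a c,
       forall c, vert c = v -> b c = a c -> log_ratio c x = log_ratio c y &
       \sum_(c | vert c == v) a c + x 0 v0 * (v == v0)%:R <=
       \sum_(c | vert c == v) b c + y 0 v0 * (v == v0)%:R].
  exists (fun c => corner_term lambda (log_ratio c x)).
  exists (fun c => corner_term lambda (log_ratio c y)); split=> [c cv|c cv abE|].
  - by apply: corner_term_le; [exact: log_ratio_gt0|exact: le3].
  - apply/le_anti/andP; split; first exact: le3.
    rewrite leNgt; apply/negP => lt3.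
    have := corner_term_lt lambda (log_ratio_gt0 c x) lt3.
    by rewrite abE ltxx.
  - by have := hxy v; rewrite !chartE.
have leS : \sum_(c | vert c == v) b c <= \sum_(c | vert c == v) a c.
  by apply: ler_sum => c /eqP; exact: ba.
have vv0 : v != v0.
  apply/negP => /eqP vv0; move: hv; rewrite -vv0 eqxx !mulr1 leNgt => /negP.
  by apply; apply: ler_ltD => //; rewrite -subr_lt0.
have {}hv : \sum_(c | vert c == v) a c <= \sum_(c | vert c == v) b c.
  by move: hv; rewrite (negbTE vv0) !mulr0 !addr0.
split=> // c cv.
have eqT : b c = a c.
  apply/le_anti/andP; split; first exact: ba.
  rewrite leNgt; apply/negP => ltT.
  move: hv; rewrite leNgt => /negP; apply.
  rewrite (bigD1 c) ?cv ?eqxx//= [ltRHS](bigD1 c) ?cv ?eqxx//=.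
  by apply: ltr_leD => //; apply: ler_sum => d /andP[/eqP ? _]; exact: ba.
have eq3 := eq_ab c cv eqT.
have p1 : 0 < next_ratio c x := expR_gt0 _.
have p2 : 0 < prev_ratio c x := expR_gt0 _.
have := le1 c cv; have := le2 c cv; move: eq3; rewrite /log_ratio => eq3 h2 h1.
(* Three weak inequalities whose sums agree are equalities. *)
have mm : next_ratio c x * prev_ratio c x <= next_ratio c y * prev_ratio c y.
  by apply: ler_pM => //; exact: ltW.
have /expR_inj e1 : next_ratio c x = next_ratio c y by lra.
have /expR_inj e2 : prev_ratio c x = prev_ratio c y by lra.
by rewrite -cv !mxE; split; lra.
Qed.

Lemma chart_inj : injective chart.
Proof.
move=> x y xy; apply/rowP => v; apply/eqP; rewrite eq_le.
by rewrite !chart_le// => w; rewrite xy.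
Qed.

(** Infinitesimal form of [chart_le]: at a negative minimum of [u] every summand of the derivative
    is nonpositive, since [corner_term'] is negative and the differences of [u] are nonnegative with
    positive weights. *)
Lemma derive_chart_ge0 x u : (forall v, 0 <= ('D_u chart x) 0 v) ->
  forall v, 0 <= u 0 v.
Proof.
move=> hu; apply: min_nonneg => v vmin vneg.
have [f [f_le0 f_eq0 hv]] : exists f : corner -> R,
   [/\ forall c, vert c = v -> f c <= 0,
       forall c, vert c = v -> f c = 0 ->
         u 0 (vert (corner_next c)) = u 0 v /\ u 0 (vert (corner_prev c)) = u 0 v &
       0 <= \sum_(c | vert c == v) f c + u 0 v0 * (v == v0)%:R].
  have p1 c : 0 < next_ratio c x * (1 + prev_ratio c x).
    by rewrite mulr_gt0 ?addr_gt0 ?expR_gt0.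
  have p2 c : 0 < prev_ratio c x * (1 + next_ratio c x).
    by rewrite mulr_gt0 ?addr_gt0 ?expR_gt0.
  have d0 c w : vert c = v -> 0 <= u 0 w - u 0 (vert c) by move=> ->; rewrite subr_ge0.
  have neg c : corner_term' lambda (log_ratio c x) < 0.
    exact/corner_term'_lt0/log_ratio_gt0.
  have := hu v; rewrite derive_chart => hv; eexists; split; last exact: hv.
  - move=> c cv; apply: mulr_le0_ge0; first exact/ltW/neg.
    by apply: addr_ge0; apply: mulr_ge0; rewrite ?d0// ltW.
  - move=> c cv /eqP; rewrite mulf_eq0 (lt_eqF (neg c))/= paddr_eq0; last 2 first.
    + by apply: mulr_ge0; [exact/ltW/p1|exact: d0].
    + by apply: mulr_ge0; [exact/ltW/p2|exact: d0].
    rewrite !(mulf_eq0 _ (_ - _)) (gt_eqF (p1 c)) (gt_eqF (p2 c))/= !subr_eq0 cv.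
    by move=> /andP[/eqP -> /eqP ->].
have f0 : \sum_(c | vert c == v) f c <= 0 by apply: sumr_le0 => c /eqP; exact: f_le0.
have vv0 : v != v0.
  apply/negP => /eqP vv0; move: hv; rewrite -vv0 eqxx mulr1 leNgt => /negP; apply.
  by rewrite (le_lt_trans _ vneg)// gerDr.
move: hv; rewrite (negbTE vv0) mulr0 addr0 => hv.
split=> // c cv; apply: f_eq0 => //.
apply/le_anti; rewrite f_le0//= leNgt; apply/negP => fneg.
move: hv; rewrite leNgt => /negP; apply.
rewrite (bigD1 c) ?cv ?eqxx//= ltr_wnDr//.
by apply: sumr_le0 => d /andP[/eqP ? _]; exact: f_le0.
Qed.

(** If [u] is in the kernel, [derive_chart_ge0] applies to both [u] and [- u]. *)
Lemma jacobian_chart_unit x : jacobian chart x \in unitmx.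
Proof.
rewrite -row_free_unit; apply: inj_row_free => u uJ.
have dH : differentiable chart x.
  by apply: differentiable_row => i; have [] := smoothP (smooth_chart i).
have ge0 (w : radii) : w *m jacobian chart x = 0 -> forall v, 0 <= w 0 v.
  by move=> wJ; apply: (@derive_chart_ge0 x) => v; rewrite deriveEjacobian// wJ mxE.
apply/rowP => v; apply/le_anti; rewrite mxE ge0// andbT.
by have := ge0 (- u) _ v; rewrite mulNmx uJ oppr0 mxE oppr_ge0; apply.
Qed.

Lemma chart_cont v : continuous (fun x => chart x 0 v).
Proof.
by move=> x; apply: differentiable_continuous; have [] := smoothP (smooth_chart v).
Qed.

Lemma chart_mono x y v : (forall w, x 0 w <= y 0 w) -> x 0 v = y 0 v ->
  chart y 0 v <= chart x 0 v.
Proof.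
move=> xy xyv; rewrite !chart_curv; apply: lerD.
  apply: curv_le => [w|w|]; rewrite !mxE ?expR_gt0 ?ler_expR//.
  by rewrite xyv.
have [vv0|] := eqVneq v v0; last by rewrite !mulr0.
by rewrite !mulr1 -vv0 xyv.
Qed.

(** Perron's method on a small box around [x]. It yields openness of the image and, through the
    control by [e], continuity of the inverse. *)
Lemma chart_open x (e : R) : 0 < e ->
  \forall k \near chart x, exists2 y : radii, `|x - y| < e & chart y = k.
Proof.
move=> e0.
have dH : differentiable chart x.
  by apply: differentiable_row => i; have [] := smoothP (smooth_chart i).
(* A direction in which all components of [chart] grow at rate 1. It is nonnegative by
   [derive_chart_ge0], so x - h z and x + h z are the opposite corners of a box. *)
have [z Dz] : exists z : radii, 'D_z chart x = const_mx 1.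
  exists (const_mx 1 *m invmx (jacobian chart x)).
  by rewrite deriveEjacobian// mulmxKV// jacobian_chart_unit.
have z0 v : 0 <= z 0 v.
  by apply: (@derive_chart_ge0 x) => w; rewrite Dz mxE.
have quot : \forall h \near (0 : R)^', forall v,
    0 < h^-1 * (chart (h *: z + x) 0 v - chart x 0 v).
  have /derivable_mxP dz : derivable chart x z by exact: diff_derivable.
  have lim1 v : h^-1 *: (chart (h *: z + x) 0 v - chart x 0 v) @[h --> 0^'] --> (1 : R).
    have := dz 0 v; rewrite /derivable /= => /cvg_ex[l hl].
    have : 'D_z (fun y => chart y 0 v) x = 1.
      have /matrixP/(_ 0 v) := derive_mx (@diff_derivable _ _ _ chart x z dH).
      by rewrite Dz !mxE => <-.
    by rewrite /derive (cvg_lim _ hl)// => <-.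
  apply: filter_forall => v; have /cvgr_gt := lim1 v; apply; exact: ltr01.
have [d d0 dQ] : exists2 d : R, 0 < d & forall h : R, `|h| < d -> h != 0 ->
    forall v, 0 < h^-1 * (chart (h *: z + x) 0 v - chart x 0 v).
  have /nbhs_ballP[d /= d0 dQ] := quot; exists d => // h hd h0; apply: dQ => //.
  by rewrite /ball/= sub0r normrN.
(* A positive strict upper bound for all [z 0 v], so that h <= e / Z keeps the box within distance
   [e] of [x]. *)
pose Z := 1 + \sum_v z 0 v.
have Z0 : 0 < Z by rewrite ltr_wpDr// sumr_ge0.
have zZ v : z 0 v < Z.
  by rewrite /Z (bigD1 v)//= addrCA ltrDl ltr_wpDr// sumr_ge0.
pose h := Num.min (d / 2) (e / Z).
have h0 : 0 < h by rewrite lt_min !divr_gt0.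
have hd : h < d by rewrite /h gt_min ltr_pdivrMr// ltr_pMr// ltr1n.
have hz v : h * z 0 v < e.
  apply: (@lt_le_trans _ _ (h * Z)); first by rewrite ltr_pM2l.
  by rewrite -ler_pdivlMr// /h ge_min lexx orbT.
have chart_b v : chart x 0 v < chart (h *: z + x) 0 v.
  have := dQ h; rewrite gtr0_norm// hd gt_eqF// => /(_ isT isT v).
  by rewrite pmulr_rgt0 ?invr_gt0// subr_gt0.
have chart_a v : chart (- h *: z + x) 0 v < chart x 0 v.
  have := dQ (- h); rewrite normrN gtr0_norm// hd oppr_eq0 gt_eqF// => /(_ isT isT v).
  by rewrite invrN mulNr -mulrN pmulr_rgt0 ?invr_gt0// opprB subr_gt0.
have : \forall k \near chart x, forall v,
    chart (- h *: z + x) 0 v < (k : radii) 0 v < chart (h *: z + x) 0 v.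
  by apply: near_row_itv => v; rewrite chart_a chart_b.
apply: filterS => k hk.
have [v|v|v|y ybox <-] := @perron _ _ chart chart_cont chart_mono
  (- h *: z + x) (h *: z + x) k.
- have := mulr_ge0 (ltW h0) (z0 v); rewrite !mxE; move: (z 0 v) => t; lra.
- by have /andP[] := hk v.
- by have /andP[] := hk v.
exists y => //.
rewrite [ltLHS]/Num.Def.normr/= mx_normrE; apply/bigmax_ltP; split=> // -[i v] _.
rewrite !mxE/= (ord1 i) ltr_norml.
have := ybox v; rewrite !mxE; have := hz v; move: (h * z 0 v) (z 0 v) => t s.
by rewrite mulNr => ? /andP[? ?]; apply/andP; split; lra.
Qed.

End Chart.

(** * The Euclidean image as a coordinate hyperplane in the global chart *)

Section Submanifold.
Variables (R : realType) (lambda : R) (S : closed_tri_surface).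
Variable v0 : 'I_(nvert S).
Local Notation radii := 'rV[R]_(nvert S).
Local Notation chart := (@chart R lambda S v0).

(** By scale invariance each Euclidean metric may be normalized to [p 0 v0 = 1], that is to
    [x 0 v0 = 0], where [chart] is the curvature. *)
Lemma image_eucl_chart :
  curv lambda 0 @` CP R S = chart @` [set x : radii | x 0 v0 = 0].
Proof.
have chart0 (y : radii) : y 0 v0 = 0 -> chart y = curv lambda 0 (map_mx expR y).
  by move=> y0; rewrite /chart y0 scale0r addr0.
apply/seteqP; split=> [_ [p p0 <-]|_ [x x0 <-]]; last first.
  exists (map_mx expR x); last by rewrite chart0.
  by move=> v; rewrite mxE expR_gt0.
pose y : radii := \row_v ln (p 0 v / p 0 v0).
have y0 : y 0 v0 = 0 by rewrite mxE divff ?ln1// gt_eqF.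
exists y => //; rewrite chart0//.
have -> : map_mx expR y = (p 0 v0)^-1 *: p.
  by apply/rowP => v; rewrite !mxE lnK ?posrE ?divr_gt0// mulrC.
by rewrite curv_scale ?invr_gt0// mul0r.
Qed.

Lemma submanifold_image_eucl : smooth_submanifold 1 (curv lambda 0 @` CP R S).
Proof.
pose U := range chart.
(* The inverse of [chart], meaningful on [U] only; outside, [get] returns a default value. *)
pose phi (y : radii) := get [set x | chart x = y].
have phiK y : U y -> chart (phi y) = y.
  by move=> [x _ xy]; exact: (@getPex _ [set x | chart x = y] (ex_intro _ x xy)).
have chartK x : phi (chart x) = x.
  by apply: (@chart_inj _ lambda _ v0); apply: phiK; exists x.
have oU : open U.
  rewrite openE => _ [x _ <-].
  by apply: filterS (chart_open lambda v0 x ltr01) => _ [y _ <-]; exists y.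
have cphi y : U y -> {for y, continuous phi}.
  move=> [x _ <-]; suff : phi t @[t --> chart x] --> phi (chart x) by [].
  rewrite chartK.
  apply/(@cvgrPdist_lt _ _ _ _ (nbhs_filter (chart x))) => e e0.
  apply: filterS (chart_open lambda v0 x e0) => _ [z xz <-].
  by rewrite chartK.
move=> p Mp; exists U, setT, phi, chart, [set v0]%SET.
have Up : U p.
  by move: Mp; rewrite image_eucl_chart => -[x _ <-]; exists x.
split; first by split=> //; exact: openT.
have dchart x : differentiable chart x.
  by apply: differentiable_row => i; have [] := smoothP (smooth_chart lambda v0 i).
split.
  split.
  - apply: (@smooth_on_inverse _ _ chart phi U) => //.
    + exact: jacobian_chart_unit.
    + exact: smooth_chart.
  - by apply: smooth_onT => i; exact: smooth_chart.
  - by move=> y Uy; split=> //; exact: phiK.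
  - by move=> x _; split; [exists x|exact: chartK].
split; first exact: cards1.
move=> y Uy; rewrite image_eucl_chart; split=> [[x x0 <-] i /set1P ->|h].
  by rewrite chartK.
by exists (phi y); [apply: h; rewrite set11|exact: phiK].
Qed.

End Submanifold.

Theorem theorem8p1 (R : realType) (lambda : R) (hlambda : lambda <= -1)
    (S : closed_tri_surface) :
  (smooth_submanifold 1 (K_eucl lambda S @` CP R S) /\
   closed (K_eucl lambda S @` CP R S)) /\
  (open (K_hyp lambda S @` CP R S) /\
   topological_boundary (K_hyp lambda S @` CP R S)
     `<=` K_eucl lambda S @` CP R S).
Proof.
have /card_gt0P[f0 _] := @face_nonempty S.
rewrite image_K_eucl image_K_hyp; split; split.
- apply: submanifold_image_eucl; exact: vert (f0, 0).
- exact: closed_image_eucl.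
- exact: open_image_hyp.
- exact: boundary_image_hyp.
Qed.
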